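(* For every $\alpha\in(0,2)$ and $p>0$ there exist constants $\mathcal C_1,\mathcal C_2>0$ such that $\big|\mathbb E[(\xi_\alpha^\delta(T))^p]-\mathbb E[(\xi_\alpha^\delta)^p]\big|\le \mathcal C_1e^{-\mathcal C_2T^\alpha}$ for all $(\delta,T)\in[0,1]\times[1,\infty)$.
   Context: $B_\alpha$ is fractional Brownian motion with $\mathrm{Cov}(B_\alpha(t),B_\alpha(s))=\frac{|t|^\alpha+|s|^\alpha-|t-s|^\alpha}{2}$, $t,s\in\mathbb R$, and $Z_\alpha(t)=\sqrt2B_\alpha(t)-|t|^\alpha$. For $a\le b$, $\delta>0$ let $[a,b]_\delta=[a,b]\cap\delta\mathbb Z$. For $\delta>0$: $\xi_\alpha^\delta=\dfrac{\sup_{t\in\delta\mathbb Z}e^{Z_\alpha(t)}}{\delta\sum_{t\in\delta\mathbb Z}e^{Z_\alpha(t)}}$ and $\xi_\alpha^\delta(T)=\dfrac{\sup_{t\in[-T,T]_\delta}e^{Z_\alpha(t)}}{\delta\sum_{t\in[-T,T]_\delta}e^{Z_\alpha(t)}}$. For $\delta=0$, the suprema are over $\mathbb R$ and $[-T,T]$ respectively and the denominators are $\int_{\mathbb R}e^{Z_\alpha(t)}dt$ and $\int_{-T}^Te^{Z_\alpha(t)}dt$. *)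

(* Defs.v *)
From HB Require Import structures.
From mathcomp Require Import all_boot all_order all_algebra.
From mathcomp Require Import all_classical all_reals all_analysis.
From mathcomp Require Import normal_distribution.
Set Implicit Arguments. Unset Strict Implicit. Unset Printing Implicit Defensive.
Import Order.TTheory GRing.Theory Num.Theory.
Import numFieldNormedType.Exports.
Local Open Scope classical_set_scope.
Local Open Scope ring_scope.

Section Defs.
Context {R : realType}.

Definition fbm_cov (a t s : R) : R :=
  (`|t| `^ a + `|s| `^ a - `|t - s| `^ a) / 2.

Definition centered_gaussian_rv {d} {Omega : measurableType d}
  (P : probability Omega R) (X : Omega -> R) (v : R) : Prop :=
  measurable_fun setT X /\
  if v == 0 then P [set w | X w = 0] = 1%E
  else forall A : set R, measurable A ->
         P (X @^-1` A) = normal_prob 0 (Num.sqrt v) A.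

(* B is a fractional Brownian motion of index a on (Omega, P):
   a centered Gaussian process (every finite linear combination is centered
   Gaussian with the variance prescribed by fbm_cov) with continuous paths. *)
Definition is_fBm {d} {Omega : measurableType d} (P : probability Omega R)
  (a : R) (B : R -> Omega -> R) : Prop :=
  (forall (n : nat) (c t : 'I_n -> R),
     centered_gaussian_rv P (fun w => \sum_(i < n) c i * B (t i) w)
       (\sum_(i < n) \sum_(j < n) c i * c j * fbm_cov a (t i) (t j)))
  /\ (forall w, continuous (fun t => B t w)).

Definition Zproc {Omega : Type} (a : R) (B : R -> Omega -> R) (w : Omega)
  (t : R) : R := Num.sqrt 2 * B t w - `|t| `^ a.

Definition xi_full (delta : R) (f : R -> R) : R :=
  if delta == 0 then
    sup [set expR (f t) | t in [set: R]] /
    fine (\int[lebesgue_measure]_(t in [set: R]) (expR (f t))%:E)%E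
  else
    sup [set expR (f (k%:~R * delta)) | k in [set: int]] /
    (delta * fine (\esum_(k in [set: int]) (expR (f (k%:~R * delta)))%:E)).

Definition xi_trunc (delta T : R) (f : R -> R) : R :=
  if delta == 0 then
    sup [set expR (f t) | t in `[- T, T]] /
    fine (\int[lebesgue_measure]_(t in `[(- T)%R, T]%classic) (expR (f t))%:E)%E
  else
    sup [set expR (f (k%:~R * delta)) | k in [set k : int | `|k%:~R * delta| <= T]] /
    (delta * \sum_(k \in [set k : int | `|k%:~R * delta| <= T]) expR (f (k%:~R * delta))).

End Defs.

(* Main.v *)
Require Import Defs.
From HB Require Import structures.
From mathcomp Require Import all_boot all_order all_algebra.
From mathcomp Require Import all_classical all_reals all_analysis.
From mathcomp Require Import measurable_realfun normal_distribution.
From mathcomp Require Import ring lra.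
Import Order.TTheory GRing.Theory Num.Theory.
Import numFieldNormedType.Exports.
Local Open Scope classical_set_scope.
Local Open Scope ring_scope.

Set Implicit Arguments.
Unset Strict Implicit.
Unset Printing Implicit Defensive.

(** Write [b = sqrt 2 * B], [f t = b t - |t|^a], and let [Y_k] be the oscillation
    of [b] within distance 1 of the integer [k]. On the unit blocks touching [k],
    [f <= b k + Y_k - |k|^a] away from the origin and
    [f >= b k - Y_k - |k|^a - 1] towards it, so the ratio of the peak of
    [exp f] in the block to the mass near it is at most a constant times
    [exp (2 Y_k)], uniformly in [delta]. As [exp (f 0) = 1], the block of the
    maximum has [b k + Y_k - |k|^a >= 0], which has probability decaying like
    [exp (- c |k|^a)]; this pays for the union over [k].

    All of this is encoded in one random variable [W] with
    [exp (lam Y_k + b k / 4 - 3 |k|^a / 16) <= W] for every [k], whose expectation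
    is bounded in terms of [a] and [lam] only: the variance of [b k] is
    [2 |k|^a], so [exp (b k / 2)] has mean [exp (|k|^a / 4)], and dyadic chaining
    gives [exp (2 lam Y_k)] a mean bounded uniformly in [k]. Pathwise, with
    [lam = 8 p + 1], both [xi^p] are [O(W^(1/4))],
    [exp f <= C W^4 exp (- |t|^a / 16)], and the reciprocal mass is [O(W)]. If
    the maximum lies outside [[-T, T]], then [1 <= C W^4 exp (- T^a / 16)];
    otherwise only the denominators differ, by a relative error at most
    [C W^5 exp (- T^a / 32)]. Taking the power 1/8 of these bounds, the difference
    is in both cases at most [C W exp (- T^a / 256)]; then integrate. *)

(** * Pathwise estimates *)

(** Rounding towards zero gives [|k|^a <= |t|^a], so in an upper bound the drift at [t] may be
    replaced by the one at [k]. *)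
Lemma int_towards_zero (R : realType) (t : R) : exists k : int,
  [/\ `|k%:~R : R| <= `|t|, `|t - k%:~R| <= 1 & `|t| <= `|k%:~R : R| + 1].
Proof.
have [t0|t0] := leP 0 t.
- exists (Num.floor t); have /andP[h1 h2] := floor_itv t.
  have h3 : (0 : R) <= (Num.floor t)%:~R by rewrite ler0z floor_ge0.
  rewrite intrD in h2.
  by rewrite !ger0_norm //; [split; lra|lra].
- exists (Num.ceil t); have /andP[h1 h2] := ceil_itv t.
  have h3 : (Num.ceil t)%:~R <= (0 : R) by rewrite lerz0 ceil_le0 ltW.
  rewrite intrB in h1.
  by rewrite (ltr0_norm t0) (ler0_norm h3) ler_norml; split; lra.
Qed.

Section pathwise.
Context (R : realType) (a p L : R) (b : R -> R).
Hypotheses (a02 : 0 < a < 2) (p0 : 0 < p) (b0 : b 0 = 0).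

Local Notation lam := (8 * p + 1).
Local Notation f t := (b t - `|t : R| `^ a).

(** [L] is the logarithm of the random majorant at a fixed outcome. The coefficient [8 p + 1] is
    chosen so that a loss of twice the oscillation in the exponent, raised to the power [p], costs
    only [exp (L / 4)] on the blocks that matter. *)
Hypothesis dom : forall (k : int) (u : R), `|u| <= 1 ->
  lam * `|b (k%:~R + u) - b k%:~R| + b k%:~R / 4
    - 3 / 16 * `|k%:~R| `^ a <= L.

(* The bound on the oscillation of [b] around [k] obtained by solving [dom]. *)
Definition osc_bound (k : int) : R :=
  (L - b k%:~R / 4 + 3 / 16 * `|k%:~R| `^ a) / lam.
Local Notation y := osc_bound.

Let a_gt0 : 0 < a. Proof. by case/andP: a02. Qed.
Let powR1a : (1 : R) `^ a = 1. Proof. by rewrite powR1. Qed.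
Let lam_gt0 : 0 < lam. Proof. by have := p0; lra. Qed.

Let lamyE k : lam * y k = L - b k%:~R / 4 + 3 / 16 * `|k%:~R| `^ a.
Proof. by rewrite /osc_bound mulrC divfK// gt_eqF. Qed.

Let osc_le k u : `|u| <= 1 -> `|b (k%:~R + u) - b k%:~R| <= y k.
Proof.
move=> /(dom k) h; rewrite -(ler_pM2l lam_gt0) lamyE; lra.
Qed.

Let y_ge0 k : 0 <= y k.
Proof. by apply: le_trans (@osc_le k 0 _); rewrite ?normr0. Qed.

Let L_ge0 : 0 <= L.
Proof.
have := @dom 0 0; rewrite mulr0z normr0 addr0 subrr normr0 mulr0 b0.
by rewrite powR0 ?gt_eqF// => /(_ ler01); lra.
Qed.

Lemma path_le_int t : exists k : int,
  [/\ `|k%:~R : R| <= `|t|, `|t| <= `|k%:~R : R| + 1 &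
      f t <= b k%:~R + y k - `|k%:~R| `^ a].
Proof.
have [k [h1 h2 h3]] := int_towards_zero t.
exists k; split => //.
have := @osc_le k _ h2; rewrite [_ + (t - _)]addrC subrK ler_norml => /andP[_ h4].
have h5 : `|k%:~R : R| `^ a <= `|t| `^ a.
  by rewrite ge0_ler_powR ?nnegrE ?(ltW a_gt0).
lra.
Qed.

(** By [lamyE], [b k + y k - |k|^a] equals [4 L - (4 lam - 1) y k - |k|^a / 4]. For [k != 0] one has
    [|t| <= 2 |k|], and [2^a <= 4] brings the drift back to [t]. *)
Lemma path_upper t : f t <= 4 * L + 1 - `|t| `^ a / 16.
Proof.
have [k [h1 h2 h3]] := path_le_int t.
have hp : 0 <= p * y k by rewrite mulr_ge0 ?(ltW p0).
have hy := lamyE k; have hy0 := y_ge0 k.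
suff : `|t| `^ a <= 4 * (`|k%:~R| `^ a) + 4.
  move=> h; nra.
have hk0 : 0 <= `|k%:~R : R| `^ a by exact: powR_ge0.
have [k0|k0] := eqVneq k 0.
  rewrite (@le_trans _ _ 1)//; last lra.
  rewrite -[X in _ <= X]powR1a ge0_ler_powR ?nnegrE ?(ltW a_gt0)//.
  by move: h2; rewrite k0 normr0 add0r.
have k1 : 1 <= `|k%:~R : R|.
  by rewrite -intr_norm -[1]/(1%:~R) ler_int -gtz0_ge1 normr_gt0.
rewrite (@le_trans _ _ ((2 * `|k%:~R|) `^ a))//.
  by rewrite ge0_ler_powR ?nnegrE ?(ltW a_gt0) ?mulr_ge0//; lra.
rewrite powRM//.
suff : (2 : R) `^ a <= 4 by nra.
rewrite (_ : 4 = (2 : R) `^ 2); last by rewrite powR_mulrn// expr2; lra.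
by apply: ler_powR; [lra|case/andP: a02; lra].
Qed.

(* The unit interval next to [k] on the side of the origin: there the drift is
   at least [- `|k| `^ a], except for [k = 0], where it is at least [- 1]. *)
Lemma path_lower k (T : R) : `|k%:~R| <= T -> 1 <= T -> exists m : int,
  [/\ - T <= m%:~R, m%:~R + 1 <= T &
  forall t, m%:~R <= t <= m%:~R + 1 ->
    b k%:~R - y k - `|k%:~R| `^ a - 1 <= f t].
Proof.
move=> kT T1.
have [k0|k0] := leP k 0.
- exists k; have hk : k%:~R <= (0 : R) by rewrite lerz0.
  move: kT; rewrite (ler0_norm hk) => kT.
  split; [lra|lra|] => t /andP[t1 t2].
  have := @osc_le k (t - k%:~R); rewrite [_ + (t - _)]addrC subrK.
  have -> : `|t - k%:~R| <= 1 by rewrite ger0_norm; lra.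
  move=> /(_ isT); rewrite ler_norml => /andP[h4 _].
  suff : `|t| `^ a <= (- k%:~R) `^ a + 1 by lra.
  have [k1|k1] := leP k (- 1).
    have hk1 : k%:~R <= (- 1 : R) by rewrite -[-1 : R]/((-1)%:~R) ler_int.
    have : `|t| `^ a <= (- k%:~R) `^ a.
      by rewrite ge0_ler_powR ?nnegrE ?(ltW a_gt0) ?oppr_ge0// ler_norml; lra.
    lra.
  have kz : k = 0 by apply/eqP; rewrite eq_le k0 /= -(addNr (1 : int)) lezD1.
  subst k; rewrite oppr0 powR0 ?gt_eqF// add0r.
  rewrite -[X in _ <= X]powR1a ge0_ler_powR ?nnegrE ?(ltW a_gt0)// ler_norml; lra.
- exists (k - 1); have hk : 1 <= (k%:~R : R).
    by rewrite -[1 : R]/(1%:~R) ler_int -gtz0_ge1.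
  move: kT; rewrite gtr0_norm; last lra.
  rewrite intrB => kT.
  split; [lra|lra|] => t /andP[t1 t2].
  have := @osc_le k (t - k%:~R); rewrite [_ + (t - _)]addrC subrK.
  have -> : `|t - k%:~R| <= 1 by rewrite ler_norml; lra.
  move=> /(_ isT); rewrite ler_norml => /andP[h4 _].
  suff : `|t| `^ a <= (k%:~R) `^ a by lra.
  by rewrite ge0_ler_powR ?nnegrE ?(ltW a_gt0)// ?ler_norml; lra.
Qed.

(** The one property of a mass used below, stated so as to cover integrals and grid sums alike. The
    loss of a factor [e] absorbs the discretisation: a grid of step at most 1 gives a unit interval
    mass at least [1/2]. *)
Local Notation mass_ge T S := (forall (m : int) (l : R),
  - T <= m%:~R -> m%:~R + 1 <= T ->
  (forall t, m%:~R <= t <= m%:~R + 1 -> l <= f t) -> expR (l - 1) <= S).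

Let f0 : f 0 = 0. Proof. by rewrite b0 normr0 powR0 ?gt_eqF// subrr. Qed.

(** The block of the origin suffices: there [b 0 = 0] turns [lamyE] into [lam * y 0 = L], hence
    [y 0 <= L]. *)
Lemma mass_lower (T S : R) : 1 <= T -> mass_ge T S -> expR (- (2 + L)) <= S.
Proof.
move=> T1 hS.
have [m [m1 m2 hm]] := @path_lower 0 T (ltac:(by rewrite mulr0z normr0; lra)) T1.
apply: le_trans (hS m _ m1 m2 hm); rewrite ler_expR.
have hy := lamyE 0; have hy0 := y_ge0 0.
have hp : 0 <= p * y 0 by rewrite mulr_ge0 ?(ltW p0).
move: hy; rewrite mulr0z b0 normr0 powR0 ?gt_eqF// => hy; lra.
Qed.

(* Where [f t >= 0], [b k + y k - |k|^a >= 0] forces [8 p * y k <= L], so the ratio of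
   the peak to the mass next to it is controlled by [L]. *)
Lemma path_le_mass (T S t : R) : 1 <= T -> mass_ge T S -> `|t| <= T ->
  expR (f t) <= S * expR (2 + L / (4 * p)).
Proof.
move=> T1 hS.
(* A negative value [f t] is beaten by [f 0 = 0], so only points with a nonnegative value remain. *)
suff key u : 0 <= f u -> `|u| <= T -> expR (f u) <= S * expR (2 + L / (4 * p)).
  move=> tT; have [ft0|ft0] := leP 0 (f t); first exact: key.
  apply: (@le_trans _ _ (expR (f 0))).
    by rewrite ler_expR f0 ltW.
  by apply: key; rewrite ?f0// normr0; lra.
move=> fu uT.
have [k [h1 h2 h3]] := path_le_int u.
have [m [m1 m2 hm]] := @path_lower k T (le_trans h1 uT) T1.
apply: le_trans (ler_wpM2r (expR_ge0 _) (hS m _ m1 m2 hm)).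
rewrite -expRD ler_expR.
have hy := lamyE k.
have hk0 : 0 <= `|k%:~R : R| `^ a by exact: powR_ge0.
suff : 2 * y k <= L / (4 * p) by lra.
rewrite ler_pdivlMr; last by have := p0; lra.
have hy0 := y_ge0 k; nra.
Qed.

Lemma ratio_powR_le (A : set R) (T S : R) :
  1 <= T -> mass_ge T S -> A 1 ->
  (forall x, A x -> x <= S * expR (2 + L / (4 * p))) ->
  (sup A / S) `^ p <= expR (2 * p + L / 4).
Proof.
move=> T1 hS A1 hA.
have S0 : 0 < S := lt_le_trans (expR_gt0 _) (mass_lower T1 hS).
have sA : has_sup A.
  by split; [exists 1|exists (S * expR (2 + L / (4 * p)))].
have s1 : 1 <= sup A by exact: (sup_upper_bound sA).
have -> : expR (2 * p + L / 4) = expR (2 + L / (4 * p)) `^ p.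
  rewrite -expRM; congr expR; field; by have := p0; lra.
apply: ge0_ler_powR.
- exact: ltW.
- by rewrite nnegrE divr_ge0 ?(ltW S0)//; lra.
- by rewrite nnegrE expR_ge0.
- rewrite ler_pdivrMr// mulrC; apply: ge_sup => //; by exists 1.
Qed.

(** The left side is at most [min 1 (p x)], which allows the exponent [z] to be weakened to [z / 8].
    This keeps the power of [exp L] in the final bound at most one. *)
Lemma ratio_powR_decr (x z : R) : 0 <= x -> x <= expR z ->
  1 - (1 + x)^-1 `^ p <= (1 + p) * expR (z / 8).
Proof.
move=> x0 xz.
have hp := p0.
have ez : 0 < expR (z / 8) by exact: expR_gt0.
have w0 : 0 <= (1 + x)^-1 `^ p by exact: powR_ge0.
have [z0|z0] := leP 0 z.
  have : 1 <= expR (z / 8) by rewrite -[leLHS]expR0 ler_expR; lra.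
  nra.
(* Write the power as [exp (- p ln (1 + x))] and use [exp s >= 1 + s] and [ln (1 + x) <= x]. *)
have h : 1 - p * x <= (1 + x)^-1 `^ p.
  rewrite -(@lnK _ ((1 + x)^-1)) ?posrE ?invr_gt0; last by lra.
  rewrite -expRM lnV ?posrE; last by lra.
  apply: le_trans (expR_ge1Dx _).
  have : ln (1 + x) <= x by apply: le_ln1Dx; lra.
  nra.
have : expR z <= expR (z / 8) by rewrite ler_expR; lra.
nra.
Qed.

(** [D] stands for the grid or the line, [S] and [S'] for the truncated and the full mass. The cases
    are whether the full supremum exceeds the truncated one. *)
Lemma ratio_powR_diff (D : set R) (T S S' kap : R) :
  D 0 -> 1 <= T -> 0 <= kap -> mass_ge T S ->
  (forall T' : R, 1 <= T' -> mass_ge T' S') -> S <= S' ->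
  S' <= S + expR (kap + (4 * L + 1) - T `^ a / 32) ->
  let X := sup [set expR (f t) | t in D `&` [set t | `|t| <= T]] / S in
  let X' := sup [set expR (f t) | t in D] / S' in
  [/\ X `^ p <= expR (2 * p) * expR L, X' `^ p <= expR (2 * p) * expR L &
   `|X `^ p - X' `^ p| <=
     (1 + p) * expR (2 * p + (kap + 3) / 8) * expR (- (256^-1 * T `^ a)) * expR L].
Proof.
move=> D0 T1 kap0 hS hS' SS' S'le X X'.
set A := [set expR (f t) | t in D `&` _] in X *.
set A' := [set expR (f t) | t in D] in X' *.
have S0 : 0 < S := lt_le_trans (expR_gt0 _) (mass_lower T1 hS).
have S'0 : 0 < S' := lt_le_trans S0 SS'.
have A1 : A 1 by exists 0; [split => //=; rewrite normr0; lra|by rewrite f0 expR0].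
have AA' : A `<=` A' by move=> _ [t [Dt _] <-]; exists t.
have bA x : A x -> x <= S * expR (2 + L / (4 * p)).
  by move=> [t [_ tT] <-]; exact: (path_le_mass T1 hS tT).
have bA' x : A' x -> x <= S' * expR (2 + L / (4 * p)).
  (* Each point gets a window of its own, which is why [S'] is assumed to satisfy the mass bound at
     every scale. *)
  move=> [t _ <-]; apply: (@path_le_mass (Num.max 1 `|t|)).
  - by rewrite le_max lexx.
  - by apply: hS'; rewrite le_max lexx.
  - by rewrite le_max lexx orbT.
have hX : X `^ p <= expR (2 * p + L / 4) := ratio_powR_le T1 hS A1 bA.
have hX' : X' `^ p <= expR (2 * p + L / 4).
  exact: (ratio_powR_le T1 (hS' _ T1) (AA' _ A1) bA').
have hL := L_ge0.
have sA' : has_sup A'.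
  by split; [exists 1; exact: AA'|exists (S' * expR (2 + L / (4 * p)))].
have sA : has_sup A.
  by split; [exists 1|exists (S * expR (2 + L / (4 * p)))].
have X0 : 0 <= X `^ p by exact: powR_ge0.
have X'0 : 0 <= X' `^ p by exact: powR_ge0.
have Ta0 : 0 <= T `^ a by exact: powR_ge0.
have h12 : expR (2 * p + L / 4) <= expR (2 * p) * expR L.
  by rewrite -expRD ler_expR; lra.
split; [exact: le_trans h12|exact: le_trans h12|].
have p1 := p0.
have [[x A'x xA]|noA'] := pselect (exists2 x, A' x & sup A < x).
  (* some [t] outside [-T, T] has [f t >= 0], so [L] is at least of order
     [T `^ a] *)
  case: A'x xA => t Dt <- xA.
  have tT : T < `|t|.
    rewrite ltNge; apply/negP => tT.
    by move: xA; rewrite ltNge (sup_upper_bound sA)//; exists t.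
  have ft : 0 <= 4 * L + 1 - T `^ a / 16.
    apply: (@le_trans _ _ (f t)).
      rewrite -ler_expR expR0; apply: le_trans (ltW xA).
      exact: (sup_upper_bound sA).
    apply: le_trans (path_upper t) _.
    suff : T `^ a <= `|t| `^ a by lra.
    by rewrite ge0_ler_powR ?nnegrE ?(ltW a_gt0)// ?(ltW tT)//; lra.
  (* Both powers lie between 0 and this bound; a sixteenth of [ft] then gives
     [T^a / 256 <= L / 4 + 1 / 16], which pays for the decay factor. *)
  apply: (@le_trans _ _ (expR (2 * p + L / 4))).
    rewrite ler_norml; apply/andP; split; lra.
  apply: (@le_trans _ _ (1 * expR (2 * p + (kap + 3) / 8) *
      expR (- (256^-1 * T `^ a)) * expR L)).
    by rewrite mul1r -!expRD ler_expR; lra.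
  by rewrite !ler_wpM2r ?expR_ge0//; lra.
have eqA : sup A' = sup A.
  apply/eqP; rewrite eq_le; apply/andP; split.
    apply: ge_sup; first by exists 1; exact: AA'.
    move=> x A'x; rewrite leNgt; apply/negP => h; apply: noA'; by exists x.
  apply: ge_sup; first by exists 1.
  by move=> x /AA'; exact: (sup_upper_bound sA').
(* The relative tail mass: with equal suprema, [X'] is [X / (1 + x)]. *)
pose x := (S' - S) / S.
have x0 : 0 <= x by rewrite divr_ge0 ?(ltW S0)// subr_ge0.
have XX' : X' = X * (1 + x)^-1.
  rewrite /X /X' eqA /x; field.
  by rewrite (gt_eqF S0) addrC subrK (gt_eqF S'0).
have sA0 : 0 <= sup A by apply: (@le_trans _ _ 1) => //; exact: (sup_upper_bound sA).
have x0' : 0 <= (1 + x)^-1 by rewrite invr_ge0; lra.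
have Xn : 0 <= X by rewrite divr_ge0 ?(ltW S0).
(* Dividing the tail by [S] costs a factor [exp (2 + L)], by [mass_lower]. *)
have xz : x <= expR (kap + (4 * L + 1) - T `^ a / 32 + (2 + L)).
  rewrite /x ler_pdivrMr// expRD.
  apply: (@le_trans _ _ (expR (kap + (4 * L + 1) - T `^ a / 32))); first lra.
  rewrite -mulrA ler_peMr ?expR_ge0// -[leLHS]expR0.
  rewrite -[X in expR X <= _](subrr (2 + L)) expRD.
  by rewrite ler_wpM2l ?expR_ge0// (mass_lower T1 hS).
have := ratio_powR_decr x0 xz.
set w := (1 + x)^-1 `^ p => hw.
have -> : X `^ p - X' `^ p = X `^ p * (1 - w).
  by rewrite XX' (powRM p Xn x0') -/w; ring.
have w1 : 0 <= 1 - w.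
  rewrite subr_ge0 -[leRHS](_ : 1 `^ p = 1); last by rewrite powR1.
  rewrite ge0_ler_powR ?nnegrE ?(ltW p0)// invf_le1; lra.
rewrite ger0_norm; last exact: mulr_ge0.
(* The powers of [exp L] add up to [1/4 + 5/8 <= 1], and an eighth of [T^a / 32] is the [T^a / 256]
   of the claim. *)
apply: (@le_trans _ _ (expR (2 * p + L / 4) * ((1 + p) *
   expR ((kap + (4 * L + 1) - T `^ a / 32 + (2 + L)) / 8)))).
  exact: ler_pM.
rewrite mulrCA -!mulrA ler_wpM2l//; first lra.
by rewrite -!expRD ler_expR; lra.
Qed.

End pathwise.

(** * Gaussian exponential moments *)

Section integral_density.
Local Open Scope ereal_scope.
Context d (T : measurableType d) (R : realType).
Context (mu nu : {measure set T -> \bar R}) (g : T -> R).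
Hypotheses (mg : measurable_fun setT g) (g0 : forall x, (0 <= g x)%R).
Hypothesis nuE : forall A, measurable A -> nu A = \int[mu]_(x in A) (g x)%:E.

Import HBNNSimple.

Let mEg : measurable_fun setT (fun x => (g x)%:E).
Proof. exact/measurable_EFinP. Qed.

Let integral_density_nnsfun (f : {nnsfun T >-> R}) :
  \int[nu]_x (f x)%:E = \int[mu]_x ((f x)%:E * (g x)%:E).
Proof.
under [LHS]eq_integral do rewrite fimfunE -fsumEFin//.
rewrite [LHS]ge0_integral_fsum//; last 2 first.
  - by move=> r; exact/measurable_EFinP/measurableT_comp.
  - by move=> n x _; rewrite EFinM nnfun_muleindic_ge0.
under [RHS]eq_integral.
  move=> x xD; rewrite fimfunE -fsumEFin// muleC ge0_mule_fsumr; last first.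
    by move=> r; rewrite EFinM nnfun_muleindic_ge0.
  over.
rewrite [RHS]ge0_integral_fsum//; last 2 first.
  - move=> r; apply: emeasurable_funM => //.
    exact/measurable_EFinP/measurableT_comp.
  - move=> n x _; rewrite EFinM; apply: mule_ge0; first by rewrite lee_fin.
    exact: nnfun_muleindic_ge0.
apply: eq_fsbigr => r; rewrite inE => -[x _ <-].
rewrite integralZl_indic_nnsfun// integral_indic// setIT nuE//.
under [RHS]eq_integral do rewrite EFinM muleCA.
rewrite ge0_integralZl//; last 3 first.
  - apply: emeasurable_funM => //; exact/measurable_EFinP/measurable_indic.
  - by move=> y _; rewrite mule_ge0 ?lee_fin.
  - by rewrite lee_fin.
congr (_ * _); rewrite integral_mkcond; apply: eq_integral => y _.
by rewrite patchE indicE; case: ifPn => _; rewrite ?mule1 ?mule0.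
Qed.

(** Simple functions first, then monotone convergence on both sides. *)
Lemma ge0_integral_density (f : T -> \bar R) :
  measurable_fun setT f -> (forall x, 0 <= f x) ->
  \int[nu]_x f x = \int[mu]_x (f x * (g x)%:E).
Proof.
move=> mf f0; pose f_ := nnsfun_approx measurableT mf.
have f_cvg x : (f_ n x)%:E @[n --> \oo] --> f x by exact: cvg_nnsfun_approx.
transitivity (limn (fun n => \int[nu]_x (f_ n x)%:E)).
  rewrite -monotone_convergence//=.
  - by apply: eq_integral => x _; apply/esym/cvg_lim.
  - by move=> n; exact/measurable_EFinP/measurable_funTS.
  - by move=> n ? _; rewrite lee_fin.
  - by move=> ? _ ? ? mn; rewrite lee_fin; exact/lefP/nd_nnsfun_approx.
transitivity (limn (fun n => \int[mu]_x ((f_ n x)%:E * (g x)%:E))).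
  by apply: congr_lim; apply/funext => n; exact: integral_density_nnsfun.
rewrite -monotone_convergence//=.
- apply: eq_integral => x _; apply/cvg_lim => //.
  by apply: cvgeZr.
- move=> n; apply: emeasurable_funM => //.
  exact/measurable_EFinP/measurable_funTS.
- by move=> n x _; rewrite mule_ge0 ?lee_fin.
- move=> x _ m n mn; rewrite lee_wpmul2r ?lee_fin//.
  exact/lefP/nd_nnsfun_approx.
Qed.

End integral_density.

Section gaussian.
Context d (Omega : measurableType d) (R : realType) (P : probability Omega R).

(** Completing the square: [exp x] times the centered density is [exp (s^2 / 2)] times the density
    with mean [s^2]. *)
Lemma integral_expR_normal_prob (s : R) : s != 0 ->
  (\int[normal_prob 0 s]_x (expR x)%:E = (expR (s ^+ 2 / 2))%:E)%E.
Proof.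
move=> s0.
rewrite (@ge0_integral_density _ _ _ lebesgue_measure _ (normal_pdf 0 s))//.
- transitivity (\int[lebesgue_measure]_x ((expR (s ^+ 2 / 2))%:E *
      (normal_pdf (s ^+ 2) s x)%:E))%E.
    apply: eq_integral => x _.
    rewrite !normal_pdfE// /normal_fun -!EFinM; congr EFin.
    rewrite mulrCA [RHS]mulrCA -!expRD; congr (_ * expR _).
    by field.
  rewrite ge0_integralZl// ?lee_fin ?expR_ge0//.
  - by rewrite integral_normal_pdf mule1.
  - by apply/measurable_EFinP; exact: measurable_normal_pdf.
  - by move=> x _; rewrite lee_fin normal_pdf_ge0.
- exact: measurable_normal_pdf.
- by move=> x; exact: normal_pdf_ge0.
- by apply/measurable_EFinP; exact: measurable_expR.
Qed.

Lemma centered_gaussian_mgf (X : Omega -> R) (v : R) : 0 <= v ->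
  centered_gaussian_rv P X v ->
  (\int[P]_w (expR (X w))%:E = (expR (v / 2))%:E)%E.
Proof.
(* Variance 0 is a separate clause of [centered_gaussian_rv]: then [X = 0] almost surely and both
   sides are 1. *)
move=> v0 [mX]; have [-> PX0|v_neq0 law] := eqVneq v 0.
  rewrite mul0r expR0 (ge0_ae_eq_integral (g := cst 1%E))//=.
  - by rewrite integral_cst// mul1e; exact: probability_setT.
  - exact/measurable_EFinP/measurableT_comp.
  - have mX0 : measurable [set w | X w = 0].
      by rewrite -[X in measurable X]setTI; exact: (mX measurableT [set 0]).
    exists (~` [set w | X w = 0]); split.
    + exact: measurableC.
    + by apply: etrans (probability_setC P mX0) _; rewrite PX0 subee.
    + by move=> w /= h Xw; apply: h => _; rewrite Xw expR0.
have s0 : Num.sqrt v != 0 by rewrite gt_eqF// sqrtr_gt0 lt_neqAle eq_sym v_neq0.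
rewrite -[in RHS](sqr_sqrtr v0) -integral_expR_normal_prob//.
pose mX_mixin := @isMeasurableFun.Build _ _ Omega (measurableTypeR R) X mX.
pose X' : {mfun Omega >-> measurableTypeR R} := HB.pack X mX_mixin.
transitivity (\int[distribution P X']_x (expR x)%:E)%E.
  rewrite (@ge0_integral_distribution _ _ _ _ _ P X' (fun x => (expR x)%:E))//.
  by apply/measurable_EFinP; exact: measurable_expR.
by apply: eq_measure_integral => A mA _; exact: law.
Qed.

End gaussian.

(** * Deterministic sums and dyadic chaining *)

(** With [n a >= 2], [exp (c t^a) >= (c t^a / n)^n] dominates [t^2] for [t > 1]. The right side is
    summable on grids uniformly in the step, and integrable on the line. *)
Lemma expR_powR_decay (R : realType) (a c : R) : 0 < a -> 0 < c ->
  exists2 K : R, 0 < K & forall t, 0 <= t -> expR (- (c * t `^ a)) <= K / (1 + t) ^+ 2.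
Proof.
move=> a0 c0.
pose n := (Num.truncn (2 / a)).+1.
have na : 2 <= n%:R * a.
  by rewrite -ler_pdivrMr//; apply/ltW/truncnS_gt.
have n0 : 0 < n%:R :> R by rewrite ltr0n.
pose K := 4 * (1 + (n%:R / c) ^+ n).
have K0 : 0 < K by rewrite mulr_gt0// ltr_pwDl// exprn_ge0// divr_ge0// ltW.
exists K => // t t0.
have t1 : 0 < (1 + t) ^+ 2 by rewrite exprn_gt0//; lra.
rewrite ler_pdivlMr// mulrC -ler_pdivlMr ?expR_gt0// expRN invrK.
have [t_le1|t_gt1] := leP t 1.
  apply: (@le_trans _ _ 4); first by rewrite expr2; nra.
  apply: (@le_trans _ _ K).
    by rewrite /K ler_peMr// lerDl exprn_ge0// divr_ge0// ltW.
  rewrite ler_peMr ?(ltW K0)// -expR0 ler_expR.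
  by rewrite mulr_ge0 ?(ltW c0) ?powR_ge0.
apply: (@le_trans _ _ (4 * (t `^ a) ^+ n)).
  rewrite -powR_mulrn ?powR_ge0// -powRrM.
  apply: (@le_trans _ _ (4 * t `^ 2)).
    by rewrite powR_mulrn// !expr2; nra.
  by rewrite ler_wpM2l// ler_powR// ?(ltW t_gt1)// mulrC.
rewrite -[leRHS]mulrA ler_wpM2l//.
apply: (@le_trans _ _ ((n%:R / c) ^+ n * expR (c * t `^ a))); last first.
  by rewrite ler_wpM2r ?expR_ge0// lerDr.
have -> : expR (c * t `^ a) = expR (c * t `^ a / n%:R) ^+ n.
  rewrite -expRM_natl; congr expR; field.
  by rewrite pnatr_eq0.
rewrite -exprMn lerXn2r ?nnegrE ?powR_ge0//.
  by rewrite mulr_ge0 ?expR_ge0// divr_ge0// ltW.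
rewrite -ler_pdivrMl ?divr_gt0// invf_div.
apply: le_trans (expR_ge1Dx _).
by rewrite mulrAC; lra.
Qed.

Lemma sum_arith_geom (R : realFieldType) (r : R) (n : nat) : 0 <= r -> r < 1 ->
  (1 - r) ^+ 2 * \sum_(m < n) m%:R * r ^+ m <= r.
Proof.
move=> r0 r1.
have -> : (1 - r) ^+ 2 * \sum_(m < n) m%:R * r ^+ m =
    r - r ^+ n * (n%:R - (n%:R - 1) * r).
  elim: n => [|n IH]; first by rewrite big_ord0 expr0 mulr0; ring.
  rewrite big_ord_recr/= mulrDr IH (exprS r n) -natr1.
  by ring.
rewrite gerBl mulr_ge0 ?exprn_ge0//.
have : 0 <= n%:R :> R by [].
nra.
Qed.

Lemma sum_geom_le (R : realFieldType) (r : R) (n : nat) : 0 <= r -> r < 1 ->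
  (1 - r) * \sum_(m < n) r ^+ m <= 1.
Proof.
move=> r0 r1.
have -> : (1 - r) * \sum_(m < n) r ^+ m = 1 - r ^+ n.
  elim: n => [|n IH]; first by rewrite big_ord0 expr0; ring.
  by rewrite big_ord_recr/= mulrDr IH (exprS r n); ring.
by rewrite gerBl exprn_ge0.
Qed.

(** Telescoping: [delta / (x + delta)^2 <= 1 / x - 1 / (x + delta)] with [x = 1 + k delta], which
    gives a bound uniform in [delta]. *)
Lemma grid_sum_le (R : realFieldType) (delta : R) (n : nat) : 0 < delta ->
  delta * \sum_(k < n) (1 + k.+1%:R * delta) ^- 2 <= 1.
Proof.
move=> d0.
have pos k : 0 < 1 + k%:R * delta by rewrite ltr_wpDr// mulr_ge0// ltW.
suff h : delta * \sum_(k < n) (1 + k.+1%:R * delta) ^- 2 <= 1 - (1 + n%:R * delta)^-1.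
  by apply: le_trans h _; rewrite gerBl invr_ge0 ltW.
elim: n => [|n IH]; first by rewrite big_ord0 mul0r addr0 invr1 subrr mulr0.
rewrite big_ord_recr/= mulrDr -lerBrDr; apply: le_trans IH _.
have x0 := pos n; have y0 := pos n.+1.
have yE : 1 + n.+1%:R * delta = 1 + n%:R * delta + delta by rewrite -natr1; ring.
move: y0; rewrite yE; set x := 1 + n%:R * delta in x0 * => y0.
rewrite -subr_ge0.
have -> : 1 - (x + delta)^-1 - delta * (x + delta) ^- 2 - (1 - x^-1) =
    delta ^+ 2 / (x * (x + delta) ^+ 2).
  by field; rewrite !gt_eqF.
by rewrite divr_ge0 ?sqr_ge0// mulr_ge0 ?sqr_ge0// ltW.
Qed.

Lemma nneseries_EFin_le (R : realType) (u : nat -> R) (M : R) :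
  (forall n, 0 <= u n) -> (forall n, \sum_(m < n) u m <= M) ->
  (\sum_(n <oo) (u n)%:E <= M%:E)%E.
Proof.
move=> u0 uM; apply: lime_le.
  by apply: is_cvg_nneseries => n _ _; rewrite lee_fin.
by apply: nearW => n; rewrite sumEFin lee_fin big_mkord.
Qed.

Section dyadic.
Context (R : realType).
Implicit Types (g : R -> R) (x : nat -> R) (t u : R).

Definition dyadic_floor (n : nat) t : R := (Num.floor (t * 2 ^+ n))%:~R / 2 ^+ n.

Let p2_gt0 n : 0 < 2 ^+ n :> R. Proof. exact: exprn_gt0. Qed.

Lemma cvg_dyadic_floor t : dyadic_floor n t @[n --> \oo] --> t.
Proof.
have h : (t - 2^-1 ^+ n) @[n --> \oo] --> t.
  rewrite -[X in _ --> X]subr0; apply: cvgB; first exact: cvg_cst.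
  by apply: cvg_expr; rewrite ger0_norm ?invr_ge0//; lra.
apply: (squeeze_cvgr _ h (cvg_cst t)); apply: nearW => n.
have /andP[h1 h2] := floor_itv (t * 2 ^+ n); rewrite intrD in h2.
rewrite /dyadic_floor ler_pdivrMr// h1 andbT ler_pdivlMr// mulrBl.
rewrite -exprMn mulVf ?expr1n//; lra.
Qed.

(** Induction on the level: an even numerator belongs to the previous level, an odd one is a single
    step of the present level away from it. *)
Lemma dyadic_step g x n i : (forall m i, (i < 2 ^ m)%N ->
     `|g (i.+1%:R / 2 ^+ m) - g (i%:R / 2 ^+ m)| <= x m) ->
  (i <= 2 ^ n)%N -> `|g (i%:R / 2 ^+ n) - g 0| <= \sum_(m < n.+1) x m.
Proof.
move=> gx.
have x0 m : 0 <= x m by apply: le_trans (gx m 0%N _); rewrite ?expn_gt0.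
elim: n i => [|n IH] i.
  rewrite expn0 big_ord1 expr0 divr1; case: i => [_|[_|//]].
    by rewrite subrr normr0.
  by have := gx 0%N 0%N; rewrite expn0 expr0 !divr1; apply.
rewrite expnS mul2n => i2; rewrite big_ord_recr /=.
have hi2 : (i./2 <= 2 ^ n)%N by rewrite -(doubleK (2 ^ n)%N) half_leq.
have half_eq : (i./2).*2%:R / 2 ^+ n.+1 = (i./2)%:R / 2 ^+ n :> R.
  rewrite -muln2 natrM exprS; field.
  by rewrite gt_eqF.
have := odd_double_half i; case: (odd i) => /= hi; last first.
  rewrite -hi add0n half_eq (le_trans (IH _ hi2))// lerDl; exact: x0.
have i2' : ((i./2).*2 < 2 ^ n.+1)%N.
  by rewrite expnS mul2n (leq_trans _ i2)// -[leqRHS]hi.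
have -> : g (i%:R / 2 ^+ n.+1) - g 0 =
    (g (i./2%:R / 2 ^+ n) - g 0) +
    (g ((i./2).*2.+1%:R / 2 ^+ n.+1) - g ((i./2).*2%:R / 2 ^+ n.+1)).
  by rewrite half_eq -[in LHS]hi add1n; ring.
apply: le_trans (ler_normD _ _) _; apply: lerD; [exact: IH|exact: gx].
Qed.

Lemma dyadic_chaining g x M u : continuous g -> (forall m i, (i < 2 ^ m)%N ->
     `|g (i.+1%:R / 2 ^+ m) - g (i%:R / 2 ^+ m)| <= x m) ->
  (forall n, \sum_(m < n) x m <= M) ->
  0 <= u <= 1 -> `|g u - g 0| <= M.
Proof.
move=> cg gx xM /andP[u0 u1].
have h : `|g (dyadic_floor n u) - g 0| @[n --> \oo] --> `|g u - g 0|.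
  apply: cvg_norm; apply: cvgB; last exact: cvg_cst.
  apply: continuous_cvg; [exact: cg|exact: cvg_dyadic_floor].
rewrite -(cvg_lim _ h)//; apply: limr_le; first by apply/cvg_ex; eexists; exact: h.
apply: nearW => n; apply: le_trans (xM n.+1).
have /andP[h1 h2] := floor_itv (u * 2 ^+ n).
have f0 : (0 <= Num.floor (u * 2 ^+ n))%R by rewrite floor_ge0 mulr_ge0 ?(ltW (p2_gt0 n)).
rewrite /dyadic_floor -(gez0_abs f0) -pmulrn.
apply: dyadic_step => //.
rewrite -(ler_nat R) pmulrn gez0_abs// (le_trans h1)// natrX ler_piMl// ltW//.
Qed.

End dyadic.

(** * An integrable majorant of fractional Brownian motion *)

Section fbm.
Context d (Omega : measurableType d) (R : realType) (P : probability Omega R).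
Context (a : R) (B : R -> Omega -> R).
Hypothesis a0 : 0 < a.
Hypothesis fB : is_fBm P a B.

Let b (t : R) (w : Omega) : R := Num.sqrt 2 * B t w.

Lemma measurable_fBm t : measurable_fun setT (B t).
Proof.
have [+ _] := fB.1 1 (fun=> 1) (fun=> t).
by under eq_fun do rewrite big_ord1 mul1r.
Qed.

Lemma continuous_fBm w : continuous (fun t => B t w).
Proof. exact: fB.2. Qed.

(** The process vanishes at the origin only almost surely; the pathwise estimates, which assume
    [b 0 = 0], are applied off this null set. *)
Lemma fBm0 : P [set w | B 0 w = 0] = 1%E.
Proof.
have [_] := fB.1 1 (fun=> 1) (fun=> 0).
rewrite !big_ord1 (_ : fbm_cov a 0 0 = 0); last first.
  by rewrite /fbm_cov subrr normr0 powR0 ?gt_eqF//; ring.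
by rewrite mulr0 eqxx; under eq_set do rewrite big_ord1 mul1r.
Qed.

Let sqrt2 : Num.sqrt 2 ^+ 2 = 2 :> R. Proof. by rewrite sqr_sqrtr. Qed.

Lemma fBm_increment_mgf (th s t : R) :
  (\int[P]_w (expR (th * (b t w - b s w)))%:E =
   (expR (th ^+ 2 * `|t - s| `^ a))%:E)%E.
Proof.
pose c (i : 'I_2) : R := if i == 0 then th * Num.sqrt 2 else - (th * Num.sqrt 2).
pose u (i : 'I_2) : R := if i == 0 then t else s.
have cv : \sum_(i < 2) \sum_(j < 2) c i * c j * fbm_cov a (u i) (u j) =
    2 * (th ^+ 2 * `|t - s| `^ a).
  rewrite !big_ord_recl !big_ord0 /c /u /= /fbm_cov !subrr normr0.
  rewrite powR0 ?gt_eqF// (distrC s t).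
  transitivity (Num.sqrt 2 ^+ 2 * (th ^+ 2 * `|t - s| `^ a)); last by rewrite sqrt2.
  by field.
have := fB.1 2 c u; rewrite cv => h.
rewrite [in RHS](_ : th ^+ 2 * _ = 2 * (th ^+ 2 * `|t - s| `^ a) / 2); last by field.
rewrite -(centered_gaussian_mgf _ h); last first.
  by do 2 rewrite mulr_ge0 ?sqr_ge0 ?powR_ge0//.
apply: eq_integral => w _; congr (expR _)%:E.
by rewrite !big_ord_recl big_ord0 /c /u /b /=; ring.
Qed.

Lemma fBm_mgf (th t : R) :
  (\int[P]_w (expR (th * b t w))%:E = (expR (th ^+ 2 * `|t| `^ a))%:E)%E.
Proof.
have := fB.1 1 (fun=> th * Num.sqrt 2) (fun=> t).
have -> : \sum_(i < 1) \sum_(j < 1) th * Num.sqrt 2 * (th * Num.sqrt 2) *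
    fbm_cov a t t = 2 * (th ^+ 2 * `|t| `^ a).
  rewrite !big_ord1 /fbm_cov subrr normr0 powR0 ?gt_eqF//.
  transitivity (Num.sqrt 2 ^+ 2 * (th ^+ 2 * `|t| `^ a)); last by rewrite sqrt2.
  by field.
move=> h.
rewrite [in RHS](_ : th ^+ 2 * _ = 2 * (th ^+ 2 * `|t| `^ a) / 2); last by field.
rewrite -(centered_gaussian_mgf _ h); last first.
  by do 2 rewrite mulr_ge0 ?sqr_ge0 ?powR_ge0//.
by apply: eq_integral => w _; congr (expR _)%:E; rewrite big_ord1 /b; ring.
Qed.

Lemma measurable_scaled_fBm t : measurable_fun setT (b t).
Proof. by apply: measurable_funM => //; exact: measurable_fBm. Qed.

(* [theta m] compensates exactly the standard deviation of the dyadic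
   increments of level [m], whose exponential moments then do not depend on
   [m]; the weights [4 ^- m] beat their number [2 ^ m]. *)
Lemma fBm_oscillation_majorant (mu s tau : R) : 0 < mu -> `|tau| = 1 ->
  let q := 1 - 2 `^ (- (a / 2)) in
  exists V : Omega -> \bar R,
  [/\ measurable_fun setT V, (forall w, (0 <= V w)%E),
    (\int[P]_w V w <=
     (4 * expR ((mu / q) ^+ 2) * expR (ln 4 * 2 `^ (- (a / 2)) / q))%:E)%E &
    forall w u, 0 <= u <= 1 ->
      ((expR (mu * `|b (s + tau * u) w - b s w|))%:E <= V w)%E].
Proof.
(* Up to the factor [sqrt 2], [r ^+ m] is the standard deviation of an increment of [b] over a step
   [2 ^- m]. *)
move=> mu0 tau1 q; set r := 2 `^ (- (a / 2)) in q *.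
have r0 : 0 < r by rewrite powR_gt0.
have r1 : r < 1.
  rewrite /r /powR pnatr_eq0/= -[ltRHS]expR0 ltr_expR mulNr oppr_lt0.
  by rewrite mulr_gt0 ?divr_gt0// ln_gt0//; lra.
have q0 : 0 < q by rewrite /q; lra.
have ln40 : 0 <= ln 4 :> R by apply: ln_ge0; lra.
pose th0 := mu / q; have th00 : 0 < th0 by rewrite divr_gt0.
pose th m := th0 / r ^+ m; have th_gt0 m : 0 < th m.
  by rewrite divr_gt0// exprn_gt0.
pose pt (m i : nat) := s + tau * (i%:R / 2 ^+ m).
pose D m i w := b (pt m i.+1) w - b (pt m i) w.
(* Adding both signs dominates the exponential of [th m * |D m i w|]. *)
pose Z m i w := 4^-1 ^+ m * (expR (th m * D m i w) + expR (- th m * D m i w)).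
pose C := expR (ln 4 * r / q).
have Z0 m i w : 0 <= Z m i w.
  by rewrite mulr_ge0 ?exprn_ge0 ?addr_ge0 ?expR_ge0// invr_ge0.
pose V w : \bar R := (\sum_(m <oo) (\sum_(i < 2 ^ m) Z m i w)%:E)%E.
have SZ0 m w : 0 <= \sum_(i < 2 ^ m) Z m i w by apply: sumr_ge0.
have V0 w : (0 <= V w)%E by apply: nneseries_ge0 => n _ _; rewrite lee_fin.
have mD m i c : measurable_fun setT (fun w => expR (c * D m i w)).
  apply: (measurableT_comp (@measurable_expR R)).
  by apply: measurable_funM => //; apply: measurable_funB;
    exact: measurable_scaled_fBm.
have mZ m i : measurable_fun setT (Z m i).
  by apply: measurable_funM => //; apply: measurable_funD.
have mSZ m : measurable_fun setT (fun w => \sum_(i < 2 ^ m) Z m i w).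
  by apply: measurable_sum.
have iD m i c : c ^+ 2 = th m ^+ 2 ->
    (\int[P]_w (expR (c * D m i w))%:E = (expR (th0 ^+ 2))%:E)%E.
  move=> cE; rewrite fBm_increment_mgf cE; congr (expR _)%:E.
  have -> : pt m i.+1 - pt m i = tau / 2 ^+ m.
    by rewrite /pt -natr1; field; rewrite gt_eqF ?exprn_gt0.
  rewrite normrM tau1 mul1r gtr0_norm ?invr_gt0 ?exprn_gt0//.
  have -> : (2 ^+ m)^-1 `^ a = (r ^+ m) ^+ 2.
    rewrite -!powR_mulrn ?powR_ge0// -powRN -!powRrM; congr (2 `^ _).
    by field.
  by rewrite /th; field; rewrite gt_eqF ?exprn_gt0.
have iZ m i : (\int[P]_w (Z m i w)%:E = (4^-1 ^+ m * (2 * expR (th0 ^+ 2)))%:E)%E.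
  rewrite /Z; under eq_integral do rewrite EFinM EFinD.
  rewrite ge0_integralZl//; last 2 first.
  - by apply: emeasurable_funD; apply/measurable_EFinP.
  - by move=> w _; rewrite adde_ge0// lee_fin expR_ge0.
  rewrite ge0_integralD//; last 2 first.
  - exact/measurable_EFinP.
  - exact/measurable_EFinP.
  by rewrite !iD ?sqrrN// -EFinD -EFinM; congr EFin; ring.
have iSZ m : (\int[P]_w (\sum_(i < 2 ^ m) Z m i w)%:E =
    (2^-1 ^+ m * (2 * expR (th0 ^+ 2)))%:E)%E.
  under eq_integral do rewrite -sumEFin.
  rewrite ge0_integral_sum//; last 2 first.
  - by move=> i; apply/measurable_EFinP.
  - by move=> i w _; rewrite lee_fin.
  under eq_bigr do rewrite iZ.
  rewrite sumEFin sumr_const card_ord -[_ *+ (2 ^ m)%N]mulr_natl natrX mulrA -exprMn.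
  by congr ((_ ^+ _ * _)%:E); field.
have iV : (\int[P]_w V w <= (4 * expR (th0 ^+ 2))%:E)%E.
  rewrite /V integral_nneseries//; last 2 first.
  - by move=> n; apply/measurable_EFinP.
  - by move=> n w _; rewrite lee_fin.
  under eq_eseriesr do rewrite iSZ.
  apply: nneseries_EFin_le => [n|n].
    by rewrite mulr_ge0 ?mulr_ge0 ?expR_ge0// exprn_ge0// invr_ge0.
  rewrite -mulr_suml.
  have := @sum_geom_le R 2^-1 n; set S := \sum_(m < n) _ => hS.
  have {hS} : (1 - 2^-1) * S <= 1 by apply: hS; lra.
  have := expR_gt0 (th0 ^+ 2); nra.
exists (fun w => (C%:E * V w)%E); split.
- by apply: measurable_funeM; apply: ge0_emeasurable_sum => [n w _ _|n _];
    [rewrite lee_fin|apply/measurable_EFinP].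
- by move=> w; rewrite mule_ge0// lee_fin expR_ge0.
- rewrite ge0_integralZl//; last 2 first.
  + by apply: ge0_emeasurable_sum => [n w _ _|n _];
      [rewrite lee_fin|apply/measurable_EFinP].
  + by rewrite lee_fin expR_ge0.
  by rewrite [X in (_ <= X%:E)%E]mulrC EFinM lee_wpmul2l// lee_fin expR_ge0.
- move=> w u u01.
  have [Vy|Vfin] := eqVneq (V w) +oo%E.
    by rewrite Vy gt0_muley ?lte_fin ?expR_gt0// leey.
  have {Vfin} : V w \is a fin_num by rewrite ge0_fin_numE// ltey.
  move=> /fineK; set v := fine (V w) => vE.
  have Zv m i : (i < 2 ^ m)%N -> Z m i w <= v.
    move=> i2; rewrite -lee_fin vE /V.
    apply: (@le_trans _ _ (\sum_(k < m.+1) (\sum_(i < 2 ^ k) Z k i w)%:E)%E).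
      rewrite sumEFin lee_fin big_ord_recr/= (bigD1 (Ordinal i2))//= addrCA lerDl.
      by apply: addr_ge0; apply: sumr_ge0 => k _; [exact: SZ0|exact: Z0].
    rewrite -(big_mkord xpredT (fun k => (\sum_(i < 2 ^ k) Z k i w)%:E)).
    by apply: nneseries_lim_ge => k _; rewrite lee_fin.
  (* The level 0 term [exp s + exp (- s)] is at least 2, so [ln v] is nonnegative. *)
  have v1 : 1 <= v.
    apply: le_trans (Zv 0%N 0%N isT); rewrite /Z expr0 mul1r.
    have := expR_ge1Dx (th 0%N * D 0%N 0%N w).
    have := expR_ge1Dx (- th 0%N * D 0%N 0%N w).
    by lra.
  have v0 : 0 < v by lra.
  have L0 : 0 <= ln v by rewrite ln_ge0.
  (* Solving [Z m i w <= v] gives [th m * |D m i w| <= ln v + m ln 4]; [M] is the sum of the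
     resulting bounds over all levels. *)
  pose x m := (ln v + m%:R * ln 4) * r ^+ m / th0.
  pose M := (ln v / q + ln 4 * r / q ^+ 2) / th0.
  have DM m i : (i < 2 ^ m)%N -> `|D m i w| <= x m.
    move=> /Zv Zm.
    suff : th m * `|D m i w| <= ln v + m%:R * ln 4.
      have rm : 0 < r ^+ m by exact: exprn_gt0.
      rewrite /x /th mulrAC ler_pdivrMr// => h.
      by rewrite ler_pdivlMr// mulrC.
    rewrite -ler_expR expRD lnK ?posrE// expRM_natl lnK ?posrE//.
    rewrite -ler_pdivrMr ?exprn_gt0// mulrC -exprVn.
    apply: le_trans Zm; rewrite /Z ler_wpM2l ?exprn_ge0 ?invr_ge0//.
    have [h|h] := leP 0 (D m i w).
      by rewrite ger0_norm// lerDl expR_ge0.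
    by rewrite ltr0_norm// mulrN mulNr lerDr expR_ge0.
  have xM n : \sum_(m < n) x m <= M.
    have -> : \sum_(m < n) x m = (ln v * \sum_(m < n) r ^+ m +
        ln 4 * \sum_(m < n) m%:R * r ^+ m) / th0.
      rewrite !mulr_sumr -big_split/= mulr_suml; apply: eq_bigr => m _.
      by rewrite /x; ring.
    rewrite /M ler_pM2r ?invr_gt0//; apply: lerD.
      by rewrite ler_wpM2l// -[leRHS]mul1r ler_pdivlMr// mulrC sum_geom_le// ltW.
    rewrite -mulrA ler_wpM2l// ler_pdivlMr ?exprn_gt0// mulrC sum_arith_geom//.
    exact: ltW.
  have cg : continuous (fun t => b (s + tau * t) w).
    move=> t; apply: cvgM; first exact: cvg_cst.
    apply: (@continuous_comp _ _ _ (fun t => s + tau * t) (fun t => B t w)).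
      apply: cvgD; first exact: cvg_cst.
      by apply: cvgM; [exact: cvg_cst|exact: cvg_id].
    exact: continuous_fBm.
  have := @dyadic_chaining R (fun t => b (s + tau * t) w) x M u cg DM xM u01.
  rewrite mulr0 addr0 => h.
  rewrite -vE -EFinM lee_fin /C -[v in X in _ <= X](lnK (x := v)) ?posrE// -expRD.
  (* Since [th0 = mu / q], [mu * M] is exactly [ln v + ln 4 * r / q]: [v] enters to the first power
     and the remainder is [ln C]. *)
  rewrite ler_expR; apply: le_trans (ler_wpM2l (ltW mu0) h) _.
  rewrite /M /th0 le_eqVlt; apply/orP; left; apply/eqP; field.
  by rewrite !gt_eqF.
Qed.

End fbm.

(** Decouples the oscillation around [k] from the value at [k], which are dependent, so that their
    expectations are bounded separately. *)
Lemma expRD_le (R : realType) (x y : R) :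
  expR (x + y) <= expR (2 * x) + expR (2 * y).
Proof.
have [xy|yx] := leP x y.
  by rewrite ler_wpDl ?expR_ge0// ler_expR; lra.
by rewrite ler_wpDr ?expR_ge0// ler_expR; lra.
Qed.

Lemma int_abs_natP (R : realType) (k : int) : exists n : nat,
  `|k%:~R : R| = n%:R /\ (k%:~R = n%:R :> R \/ k%:~R = - n%:R :> R).
Proof.
exists `|k|%N; rewrite -intr_norm -abszE -pmulrn; split=> //.
by case: k => n; [left|right; rewrite NegzE mulrNz].
Qed.

(** [W] sums a majorant over all integers, which acts as a union bound. [K] is fixed before the
    probability space, so the final constants depend only on the parameters. *)
Lemma fBm_majorant (R : realType) (a lam : R) : 0 < a -> 0 < lam ->
  exists2 K : R, 0 < K &
  forall d (Omega : measurableType d) (P : probability Omega R)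
    (B : R -> Omega -> R), is_fBm P a B ->
  let b t w := Num.sqrt 2 * B t w in
  exists W : Omega -> \bar R,
  [/\ measurable_fun setT W, (forall w, (0 <= W w)%E),
    (\int[P]_w W w <= K%:E)%E &
    forall w (k : int) (u : R), `|u| <= 1 ->
      ((expR (lam * `|b (k%:~R + u) w - b k%:~R w| + b k%:~R w / 4
         - 3 / 16 * `|k%:~R| `^ a))%:E <= W w)%E].
Proof.
move=> a0 lam0.
have [K1 K10 hK1] := @expR_powR_decay R a 16^-1 a0 (ltac:(lra)).
pose q : R := 1 - 2 `^ (- (a / 2)).
pose K0 : R := 4 * expR ((2 * lam / q) ^+ 2) * expR (ln 4 * 2 `^ (- (a / 2)) / q).
have K00 : 0 < K0 by rewrite !mulr_gt0 ?expR_gt0.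
(* Each of [n] and [- n] contributes [(2 K0 + 1) c n] to the mean, and [2 K1] bounds the sum of the
   [c n]. *)
exists ((4 * K0 + 2) * (2 * K1)).
  by rewrite !mulr_gt0//; lra.
move=> d Omega P B fB b.
have lam20 : 0 < 2 * lam by lra.
(* Oscillations to the right and to the left of a point are majorized separately, with [2 lam] in
   view of [expRD_le]. *)
have /choice[Vp hVp] s := fBm_oscillation_majorant a0 fB s lam20 (normr1 R).
have /choice[Vm hVm] s :=
  fBm_oscillation_majorant a0 fB s lam20 (etrans (normrN1 R) erefl).
pose c (n : nat) : R := expR (- (16^-1 * n%:R `^ a)).
(* For [|t| = n], [exp (b t / 2)] has mean [exp (n^a / 4)], so the weight [5 / 16] leaves the mean
   [c n]. *)
pose E (n : nat) (t : R) w : R := expR (- (5 / 16 * n%:R `^ a)) * expR (2^-1 * b t w).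
pose U (n : nat) (t : R) w : \bar R := ((c n)%:E * (Vp t w + Vm t w) + (E n t w)%:E)%E.
have Vp0 t w : (0 <= Vp t w)%E by have [_ + _ _] := hVp t; exact.
have Vm0 t w : (0 <= Vm t w)%E by have [_ + _ _] := hVm t; exact.
have mVp t : measurable_fun setT (Vp t) by have [] := hVp t.
have mVm t : measurable_fun setT (Vm t) by have [] := hVm t.
have c0 n : (0 <= (c n)%:E)%E by rewrite lee_fin expR_ge0.
have E0 n t w : (0 <= (E n t w)%:E)%E by rewrite lee_fin mulr_ge0 ?expR_ge0.
have V0 t w : (0 <= Vp t w + Vm t w)%E by rewrite adde_ge0.
have U0 n t w : (0 <= U n t w)%E by rewrite adde_ge0 ?mule_ge0.
have mE t : measurable_fun setT (fun w => (expR (2^-1 * b t w))%:E).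
  apply/measurable_EFinP; apply: (measurableT_comp (@measurable_expR R)).
  by apply: measurable_funM => //; exact: (measurable_scaled_fBm fB).
have mEE n t : measurable_fun setT (fun w => (E n t w)%:E).
  by rewrite /E; under eq_fun do rewrite EFinM; apply: measurable_funeM; exact: mE.
have mV t : measurable_fun setT (fun w => (Vp t w + Vm t w)%E).
  by apply: emeasurable_funD.
have mU n t : measurable_fun setT (U n t).
  by apply: emeasurable_funD => //; apply: measurable_funeM.
have iU n t : `|t| = n%:R -> (\int[P]_w U n t w <= ((2 * K0 + 1) * c n)%:E)%E.
  move=> tn; rewrite ge0_integralD//; last 2 first.
  - by move=> w _; rewrite mule_ge0.
  - exact: measurable_funeM.
  rewrite mulrDl mul1r EFinD; apply: leeD.
    rewrite ge0_integralZl// ge0_integralD// mulrC EFinM lee_wpmul2l//.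
    rewrite mulr2n mulrDl mul1r EFinD.
    by apply: leeD; [have [_ _ + _] := hVp t|have [_ _ + _] := hVm t].
  rewrite /E; under eq_integral do rewrite EFinM.
  rewrite ge0_integralZl//.
  rewrite (fBm_mgf a0 fB) -EFinM lee_fin -expRD /c ler_expR tn.
  by lra.
pose W w : \bar R := (\sum_(n <oo) (U n (n%:R)%R w + U n (- n%:R)%R w))%E.
exists W; split.
- apply: ge0_emeasurable_sum => [n w _ _|n _]; first by rewrite adde_ge0.
  exact: emeasurable_funD.
- by move=> w; apply: nneseries_ge0 => n _ _; rewrite adde_ge0.
- rewrite /W integral_nneseries//; last 2 first.
  + by move=> n; exact: emeasurable_funD.
  + by move=> n w _; rewrite adde_ge0.
  apply: (@le_trans _ _ (\sum_(n <oo) ((4 * K0 + 2) * c n)%:E)%E).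
    apply: lee_nneseries => n; first by move=> _ _; apply: integral_ge0 => w _; rewrite adde_ge0.
    move=> _; rewrite ge0_integralD//.
    rewrite (_ : (4 * K0 + 2) * c n = (2 * K0 + 1) * c n + (2 * K0 + 1) * c n); last by ring.
    by rewrite EFinD; apply: leeD; apply: iU; rewrite ?normrN normr_nat.
  apply: nneseries_EFin_le => n.
    by rewrite mulr_ge0 ?expR_ge0//; lra.
  rewrite -mulr_sumr ler_wpM2l//; first lra.
  case: n => [|n]; first by rewrite big_ord0; lra.
  rewrite big_ord_recl/=.
  have : c 0%N <= K1 by have := hK1 0 (lexx 0); rewrite addr0 expr1n divr1.
  suff : \sum_(i < n) c (bump 0 i) <= K1 * 1 by lra.
  apply: le_trans (ler_wpM2l (ltW K10) (grid_sum_le n ltr01)).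
  rewrite mul1r mulr_sumr; apply: ler_sum => m _; rewrite mulr1.
  exact: hK1.
- move=> w k u u1; have [n [kn kE]] := int_abs_natP R k.
  have UW : (U n k%:~R w <= W w)%E.
    apply: (@le_trans _ _ (U n (n%:R)%R w + U n (- n%:R)%R w))%E.
      by case: kE => ->; [rewrite leeDl|rewrite leeDr].
    rewrite /W (nneseriesD1 (n := n))//; last by move=> j _; rewrite adde_ge0.
    by rewrite leeDl// nneseries_ge0// => j _ _; rewrite adde_ge0.
  apply: le_trans UW; rewrite /U.
  apply: (@le_trans _ _ ((c n)%:E * (expR (2 * lam * `|b (k%:~R + u) w - b k%:~R w|))%:E
      + (E n k%:~R w)%:E)%E); last first.
    apply: leeD => //; apply: lee_wpmul2l => //.
    have [u0|u0] := leP 0 u.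
      have [_ _ _ /(_ w u)] := hVp k%:~R.
      rewrite ger0_norm// in u1; rewrite u0 u1 mul1r => /(_ isT)/le_trans; apply.
      by rewrite leeDl.
    have [_ _ _ /(_ w (- u))] := hVm k%:~R.
    rewrite ltr0_norm// in u1; rewrite u1 oppr_ge0 (ltW u0) mulN1r opprK => /(_ isT)/le_trans; apply.
    by rewrite leeDr.
  rewrite -EFinM -EFinD lee_fin /c /E -!expRD kn.
  set osc := `|_ - _|.
  (* The split [3/16 = 1/32 + 5/32] doubles to the weights [1/16] in [c] and [5/16] in [E]. *)
  have := expRD_le (lam * osc - n%:R `^ a / 32) (b k%:~R w / 4 - 5 / 32 * n%:R `^ a).
  by congr (expR _ <= expR _ + expR _); lra.
Qed.

(** * Total masses on grids and on the line *)

Section masses.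
Context (R : realType) (a : R).
Hypothesis a0 : 0 < a.
Implicit Types (delta T M kap l : R) (f : R -> R).

Definition mass_trunc delta T f : R :=
  if delta == 0 then
    fine (\int[lebesgue_measure]_(t in `[(- T)%R, T]%classic) (expR (f t))%:E)%E
  else
    delta * \sum_(k \in [set k : int | `|k%:~R * delta| <= T]) expR (f (k%:~R * delta)).

Definition mass_full delta f : R :=
  if delta == 0 then
    fine (\int[lebesgue_measure]_(t in [set: R]) (expR (f t))%:E)%E
  else delta * fine (\esum_(k in [set: int]) (expR (f (k%:~R * delta)))%:E).

Let expRN1_le : expR (- 1) <= 2^-1 :> R.
Proof. by rewrite expRN lef_pV2 ?posrE ?expR_gt0// (le_trans _ (expR_ge1Dx 1)). Qed.

Lemma sub_esum (I : choiceType) (A B : set I) (u : I -> \bar R) :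
  A `<=` B -> (forall i, 0 <= u i)%E ->
  (\esum_(i in A) u i <= \esum_(i in B) u i)%E.
Proof.
move=> AB u0; by rewrite (esumID A B)// (setIidr AB) leeDl// esum_ge0.
Qed.

Lemma finite_grid delta T : 0 < delta ->
  finite_set [set k : int | `|k%:~R * delta| <= T].
Proof.
move=> d0; pose N := (Num.truncn (T / delta)).+1.
apply: (@sub_finite_set _ _ (Posz @` `I_N `|` Negz @` `I_N)); last first.
  by rewrite finite_setU; split; apply: finite_image; exact: finite_II.
have h (n : nat) : n%:R * delta <= T -> (n < N)%N.
  rewrite -ler_pdivlMr// => nT; rewrite -(ltr_nat R).
  by apply: le_lt_trans nT _; exact: truncnS_gt.
move=> [n|n] /=; rewrite normrM (gtr0_norm d0).
  by rewrite -pmulrn normr_nat => /h nN; left; exists n.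
rewrite NegzE mulrNz normrN -pmulrn normr_nat => nT; right; exists n => //=.
apply: h; apply: le_trans nT; rewrite ler_pM2r// ler_nat; exact: leqnSn.
Qed.

(** From [j0] on, [n = floor (1 / delta)] consecutive grid points lie in the unit interval. As
    [delta n >= delta] and [delta (n + 1) > 1], their total weight exceeds [1/2], hence
    [exp (- 1)]. *)
Lemma grid_mass_ge delta T f (m : int) l : 0 < delta -> delta <= 1 ->
  - T <= m%:~R -> m%:~R + 1 <= T ->
  (forall t, m%:~R <= t <= m%:~R + 1 -> l <= f t) ->
  expR (l - 1) <=
    delta * \sum_(k \in [set k : int | `|k%:~R * delta| <= T]) expR (f (k%:~R * delta)).
Proof.
move=> d0 d1 mT mT' fl.
pose n := Num.truncn delta^-1; pose j0 := Num.ceil (m%:~R / delta).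
have /andP[h1 h2] := ceil_itv (m%:~R / delta); rewrite -/j0 intrB in h1 h2.
have d1' : 1 <= delta^-1 by rewrite invf_ge1.
have nd : n%:R <= delta^-1 by rewrite truncn_le// invr_ge0 ltW.
have nd' : delta^-1 < n%:R + 1 by rewrite natr1 truncnS_gt.
have n1 : 1 <= n%:R :> R by rewrite ler1n truncn_gt0.
pose e (i : nat) : int := j0 + i%:Z.
have eE i : (e i)%:~R = j0%:~R + i%:R :> R by rewrite intrD.
have emem i : (i < n)%N -> m%:~R <= (e i)%:~R * delta <= m%:~R + 1.
  move=> iltn; have : i%:R + 1 <= n%:R :> R by rewrite natr1 ler_nat.
  move=> i1; rewrite eE; apply/andP; split.
    rewrite -ler_pdivrMr//; have := ler0n R i; lra.
  rewrite -ler_pdivlMr// mulrDl mul1r; lra.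
rewrite -lee_fin EFinM -fsumEFin; last exact: finite_grid.
rewrite -esum_fset//; last by [move=> k _; rewrite lee_fin expR_ge0|exact: finite_grid].
apply: (@le_trans _ _ (delta%:E * \esum_(k in e @` `I_n) (expR (f (k%:~R * delta)))%:E)%E); last first.
  rewrite lee_wpmul2l ?lee_fin ?(ltW d0)//; apply: sub_esum => [|k]; last first.
    by rewrite lee_fin expR_ge0.
  move=> _ [i /= iltn <-]; have /andP[h3 h4] := emem _ iltn.
  by rewrite ler_norml; apply/andP; split; lra.
rewrite esum_image; last by move=> i j _ _ /addrI[].
rewrite esum_fset//.
rewrite -fsbig_ord sumEFin -EFinM lee_fin.
apply: (@le_trans _ _ (delta * (n%:R * expR l))).
  rewrite mulrA expRD mulrC ler_pM2r ?expR_gt0//.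
  apply: le_trans expRN1_le _.
  have : 1 < delta * (n%:R + 1) by rewrite -ltr_pdivrMl// mulr1.
  have : delta <= delta * n%:R by rewrite ler_peMr// ltW.
  nra.
rewrite ler_pM2l// -[n in n%:R]card_ord mulr_natl -sumr_const.
by apply: ler_sum => i _; rewrite ler_expR; apply: fl; exact: emem.
Qed.

Lemma integral_mass_ge f (m : int) l : continuous f ->
  (forall t, m%:~R <= t <= m%:~R + 1 -> l <= f t) ->
  ((expR (l - 1))%:E <=
   \int[lebesgue_measure]_(t in `[m%:~R, (m%:~R + 1)%R]) (expR (f t))%:E)%E.
Proof.
move=> cf fl.
apply: (@le_trans _ _ (\int[lebesgue_measure]_(t in `[m%:~R, (m%:~R + 1)%R]) (expR l)%:E)%E).
  rewrite integral_cst//= lebesgue_measure_itv/= lte_fin ltrDl ltr01.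
  by rewrite -EFinD addrAC subrr add0r mule1 lee_fin ler_expR; lra.
apply: ge0_le_integral => //=.
- apply/measurable_EFinP; apply: measurable_funTS.
  apply: (measurableT_comp (@measurable_expR R)).
  exact: continuous_measurable_fun.
- by move=> t /=; rewrite in_itv/= lee_fin ler_expR; exact: fl.
Qed.

(** As [T >= 0], the tail omits [k = 0]; each of the two half-lines is then compared with the sum in
    [grid_sum_le]. *)
Lemma grid_tail delta T f (c : R) : 0 < delta -> 0 <= T -> 0 <= c ->
  (forall t, T < `|t| -> expR (f t) <= c / (1 + `|t|) ^+ 2) ->
  (delta%:E * (\esum_(k in ~` [set k : int | (`|k%:~R * delta| <= T)%R])
     (expR (f (k%:~R * delta)))%:E) <= (2 * c)%:E)%E.
Proof.
move=> d0 T0 c0 fc.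
pose h (n : nat) : R := c * (1 + n.+1%:R * delta) ^- 2.
have h0 n : 0 <= h n by rewrite mulr_ge0// invr_ge0 sqr_ge0.
have hle : (\sum_(i <oo) (h i)%:E <= (c / delta)%:E)%E.
  apply: nneseries_EFin_le => // N; rewrite -mulr_sumr.
  rewrite ler_wpM2l// -[leRHS]mulr1 ler_pdivlMl//; exact: grid_sum_le.
have half (e : nat -> int) (A : set int) : injective e ->
    (forall n, `|(e n)%:~R : R| = n.+1%:R) ->
    A `<=` e @` [set: nat] -> A `<=` ~` [set k : int | `|k%:~R * delta| <= T] ->
    (\esum_(k in A) (expR (f (k%:~R * delta)))%:E <= (c / delta)%:E)%E.
  move=> ei en Ae AT; apply: le_trans _ hle.
  rewrite nneseries_esumT//.
  apply: (@le_trans _ _ (\esum_(k in A) (c * (1 + `|k%:~R| * delta) ^- 2)%:E)%E).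
    apply: le_esum => k Ak; rewrite lee_fin.
    have /negP := AT _ Ak; rewrite -ltNge => /fc.
    by rewrite normrM (gtr0_norm d0).
  apply: (@le_trans _ _ (\esum_(k in e @` setT) (c * (1 + `|k%:~R| * delta) ^- 2)%:E)%E).
    apply: sub_esum => // k; rewrite lee_fin mulr_ge0// invr_ge0 sqr_ge0//.
  rewrite esum_image; last by move=> i j _ _; exact: ei.
  by apply: le_esum => n _; rewrite /h en.
have dE : (2 * c)%:E = (delta%:E * ((c / delta)%:E + (c / delta)%:E))%E.
  by rewrite -EFinD -EFinM; congr EFin; field; rewrite gt_eqF.
rewrite dE lee_wpmul2l ?lee_fin ?(ltW d0)//.
rewrite (esumID (range (Posz \o S)))//; apply: leeD.
  apply: (half (Posz \o S)).
  - by move=> i j [].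
  - by move=> n /=; rewrite -pmulrn normr_nat.
  - by move=> k [].
  - by move=> k [].
apply: (half Negz).
- by move=> i j [].
- by move=> n; rewrite NegzE mulrNz normrN -pmulrn normr_nat.
- move=> [[|n]|n] [] /= h1 h2.
  + by exfalso; apply: h1; rewrite mul0r normr0.
  + by exfalso; apply: h2; exists n.
  + by exists n.
- by move=> k [].
Qed.

(** [(1 + |t|)^2 >= 1 + t^2], and the reciprocal of [1 + t^2] has integral [pi]. *)
Lemma integral_tail T f (c : R) : continuous f -> 0 <= T -> 0 <= c ->
  (forall t, T < `|t| -> expR (f t) <= c / (1 + `|t|) ^+ 2) ->
  (\int[lebesgue_measure]_(t in ~` `[(- T)%R, T]) (expR (f t))%:E
    <= (pi * c)%:E)%E.
Proof.
move=> cf T0 c0 fc.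
have mf : measurable_fun setT (fun t => (expR (f t))%:E).
  apply/measurable_EFinP; apply: (measurableT_comp (@measurable_expR R)).
  exact: continuous_measurable_fun.
have mo : measurable_fun setT (fun t : R => ((oneDsqr t)^-1)%:E).
  apply/measurable_EFinP; apply: continuous_measurable_fun.
  exact: continuous_oneDsqrV.
have o0 (t : R) : 0 <= (oneDsqr t)^-1 by rewrite invr_ge0 addr_ge0 ?sqr_ge0.
have mA : measurable (~` `[(- T)%R, T]%classic : set R) by exact: measurableC.
apply: (@le_trans _ _ (\int[lebesgue_measure]_(t in ~` `[(- T)%R, T])
    (c%:E * ((oneDsqr t)^-1)%:E))%E).
  apply: ge0_le_integral => //=.
  - by apply: measurable_funTS.
  - by apply: measurable_funeM; apply: measurable_funTS.
  - move=> t /= /negP tT; rewrite -EFinM lee_fin.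
    have {}tT : T < `|t| by rewrite ltNge ler_norml; move: tT; rewrite in_itv.
    apply: le_trans (fc _ tT) _; rewrite ler_wpM2l// lef_pV2 ?posrE.
    + rewrite /oneDsqr -(real_normK (num_real t)); have := normr_ge0 t; nra.
    + by rewrite exprn_gt0// ltr_pwDl.
    + by rewrite /oneDsqr ltr_pwDl// sqr_ge0.
rewrite ge0_integralZl//; last exact: measurable_funTS.
rewrite mulrC EFinM lee_wpmul2l// ?lee_fin//.
apply: (@le_trans _ _ (\int[lebesgue_measure]_t ((oneDsqr t)^-1)%:E)%E).
  by apply: ge0_subset_integral => // t _; rewrite lee_fin.
rewrite (ge0_symfun_integralT (f := fun t => (oneDsqr t)^-1))//.
- rewrite -set_itvcy integral0y_oneDsqr -EFinM lee_fin mulrC divfK//.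
- exact: continuous_oneDsqrV.
- by move=> t; rewrite /= /oneDsqr sqrrN.
Qed.

(** Half of the decay [|t|^a / 16] is spent on convergence of the tail, the other half yields
    [exp (- T^a / 32)]. *)
Lemma masses_bound : exists2 kap, 0 <= kap &
  forall delta f M, 0 <= delta <= 1 -> continuous f ->
  (forall t, f t <= M - `|t| `^ a / 16) -> forall T, 1 <= T ->
  [/\ (forall (m : int) l, - T <= m%:~R -> m%:~R + 1 <= T ->
        (forall t, m%:~R <= t <= m%:~R + 1 -> l <= f t) ->
        expR (l - 1) <= mass_trunc delta T f),
    mass_trunc delta T f <= mass_full delta f &
    mass_full delta f <= mass_trunc delta T f + expR (kap + M - T `^ a / 32)].
Proof.
have [K K0 hK] := @expR_powR_decay R a 32^-1 a0 (ltac:(lra)).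
(* [2 + pi] covers the grid tail [2 c] and the line tail [pi c] at once; the added 1 keeps [kap]
   nonnegative. *)
exists (ln (1 + (2 + pi) * K)).
  by rewrite ln_ge0// lerDl mulr_ge0 ?(ltW K0)// addr_ge0// pi_ge0.
move=> delta f M /andP[d0 d1] cf fM T T1.
have T0 : 0 <= T by lra.
pose c := K * expR (M - T `^ a / 32).
have c0 : 0 <= c by rewrite mulr_ge0 ?expR_ge0 ?(ltW K0).
have fc t : T < `|t| -> expR (f t) <= c / (1 + `|t|) ^+ 2.
  move=> tT; rewrite /c mulrAC.
  apply: (@le_trans _ _ (expR (- (32^-1 * `|t| `^ a)) * expR (M - T `^ a / 32))).
    rewrite -expRD ler_expR; have := fM t.
    have : T `^ a <= `|t| `^ a.
      by rewrite ge0_ler_powR ?nnegrE ?(ltW a0)// ltW.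
    lra.
  by rewrite ler_wpM2r ?expR_ge0// hK.
have cle : (2 + pi) * c <= expR (ln (1 + (2 + pi) * K) + M - T `^ a / 32).
  rewrite -(addrA (ln _)) [expR (ln _ + _)]expRD lnK ?posrE; last first.
    by rewrite ltr_wpDr// mulr_ge0 ?(ltW K0)// addr_ge0// pi_ge0.
  by rewrite /c mulrA ler_wpM2r ?expR_ge0// lerDr.
have pi0 : 0 <= pi :> R := pi_ge0 R.
rewrite /mass_trunc /mass_full; case: eqVneq => [_|dn0].
  set mu := lebesgue_measure.
  have mf : measurable_fun setT (fun t => (expR (f t))%:E).
    apply/measurable_EFinP; apply: (measurableT_comp (@measurable_expR R)).
    exact: continuous_measurable_fun.
  set I := (\int[mu]_(t in `[(- T)%R, T]) (expR (f t))%:E)%E.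
  set J := (\int[mu]_(t in ~` `[(- T)%R, T]) (expR (f t))%:E)%E.
  have J0 : (0 <= J)%E by apply: integral_ge0 => t _; rewrite lee_fin expR_ge0.
  have I0 : (0 <= I)%E by apply: integral_ge0 => t _; rewrite lee_fin expR_ge0.
  have Jle : (J <= (pi * c)%:E)%E by exact: integral_tail.
  (* Finiteness of [I] and [J] is needed to split [fine], which sends [+oo] to 0. *)
  have Ile : (I <= (expR M * (2 * T))%:E)%E.
    apply: (@le_trans _ _ (\int[mu]_(t in `[(- T)%R, T]) (expR M)%:E)%E).
      apply: ge0_le_integral => //=; first exact: measurable_funTS.
      move=> t _; rewrite lee_fin ler_expR; apply: le_trans (fM t) _.
      by rewrite gerBl divr_ge0// powR_ge0.
    rewrite integral_cst//= lebesgue_measure_itv/= lte_fin.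
    case: ifP => _; last by rewrite mule0 lee_fin mulr_ge0 ?expR_ge0// mulr_ge0.
    by rewrite -EFinD -EFinM lee_fin ler_wpM2l ?expR_ge0//; lra.
  have Ifin : I \is a fin_num by rewrite ge0_fin_numE// (le_lt_trans Ile)// ltry.
  have Jfin : J \is a fin_num by rewrite ge0_fin_numE// (le_lt_trans Jle)// ltry.
  have IJ : (\int[mu]_t (expR (f t))%:E = I + J)%E.
    rewrite -ge0_integral_setU//.
    + by rewrite setUv.
    + exact: measurableC.
    + by rewrite setUv.
    + by rewrite disj_set2E setICr.
  rewrite IJ (fineD Ifin Jfin); split.
  - move=> m l mT mT' fl; rewrite -lee_fin (fineK Ifin).
    apply: le_trans (integral_mass_ge cf fl) _; apply: ge0_subset_integral => //.
    + exact: measurable_funTS.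
    + by move=> t /=; rewrite !in_itv/= => /andP[h1 h2]; apply/andP; split; lra.
  - by rewrite lerDl fine_ge0.
  - rewrite lerD2l; apply: le_trans cle; apply: (@le_trans _ _ (pi * c)).
      by rewrite -lee_fin (fineK Jfin).
    by rewrite ler_wpM2r//; lra.
have dgt0 : 0 < delta by rewrite lt_neqAle eq_sym dn0.
set A := [set k : int | `|k%:~R * delta| <= T].
have finA : finite_set A by exact: finite_grid.
set s := \sum_(k \in A) _; set J := (\esum_(k in ~` A) (expR (f (k%:~R * delta)))%:E)%E.
have J0 : (0 <= J)%E by apply: esum_ge0 => k _; rewrite lee_fin expR_ge0.
have Jle : (delta%:E * J <= (2 * c)%:E)%E by exact: grid_tail.
have Jfin : J \is a fin_num.
  rewrite ge0_fin_numE// ltey; apply/eqP => Jy; move: Jle.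
  by rewrite Jy gt0_muley ?lte_fin// leye_eq.
have sE : (\esum_(k in [set: int]) (expR (f (k%:~R * delta)))%:E = s%:E + J)%E.
  rewrite (esumID A)// !setTI -/J; congr (_ + _)%E.
  by rewrite esum_fset// fsumEFin.
rewrite sE fineD//= mulrDr; split.
- by move=> m l; exact: grid_mass_ge.
- by rewrite lerDl mulr_ge0 ?fine_ge0.
- rewrite lerD2l; apply: le_trans cle; apply: (@le_trans _ _ (2 * c)).
    by rewrite -lee_fin EFinM fineK.
  by rewrite ler_wpM2r//; lra.
Qed.

End masses.

(** * Measurability of path functionals *)

(** Away from the origin this is [exp (a ln |t|)]; at the origin [|s| < e^(1/a)] gives [|s|^a < e]
    directly. *)
Lemma continuous_powR_norm (R : realType) (a : R) : 0 < a ->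
  continuous (fun t : R => `|t| `^ a).
Proof.
move=> a0 t; have [->|t0] := eqVneq t 0.
  rewrite /continuous_at normr0 powR0 ?gt_eqF//; apply/cvgrPdist_lt => e e0.
  have e0' : 0 < e `^ a^-1 by rewrite powR_gt0.
  near=> s.
  have es : `|s| < e `^ a^-1.
    by near: s; have := @cvgr0_norm_lt R R^o R (nbhs (0 : R)) _ id; apply.
  rewrite sub0r normrN ger0_norm ?powR_ge0//.
  have {1}-> : e = (e `^ a^-1) `^ a by rewrite -powRrM mulVf ?gt_eqF// powRr1// ltW.
  by rewrite gt0_ltr_powR ?nnegrE ?powR_ge0.
have nt : 0 < `|t| by rewrite normr_gt0.
rewrite /continuous_at.
apply: (@cvg_trans _ ((fun s => expR (a * ln `|s|)) s @[s --> t])).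
  apply: near_eq_cvg; near=> s; rewrite /powR ifF//.
  apply/negbTE; rewrite normr_eq0.
  by near: s; apply: (@cvgr_neq0 R R^o _ (nbhs t) _ id t).
rewrite /powR (gt_eqF nt).
apply: (cvg_comp _ expR); last exact: continuous_expR.
apply: cvgM; first exact: cvg_cst.
apply: (cvg_comp _ (@ln R)); last exact: continuous_ln.
exact: norm_continuous.
Unshelve. all: by end_near.
Qed.

Section path_measurability.
Context d (Omega : measurableType d) (R : realType) (g : R -> Omega -> R).
Hypothesis mg : forall t, measurable_fun setT (g t).
Hypothesis cg : forall w, continuous (fun t => g t w).

Let nat_int (i : nat) : int := odflt 0 (unpickle i).

Let nat_intK k : nat_int (pickle k) = k.
Proof. by rewrite /nat_int pickleK. Qed.

(** Freezing time at its dyadic floor gives functions that depend only on the outcome on each of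
    countably many strips; path continuity gives the limit. *)
Lemma measurable_path_joint : measurable_fun setT (fun z : R * Omega => g z.1 z.2).
Proof.
apply: (@measurable_fun_cvg _ _ _ _ (fun n (z : R * Omega) => g (dyadic_floor n z.1) z.2)); last first.
  move=> [t w] _ /=; apply: (@continuous_cvg _ _ _ _ _ _ (fun t => g t w)).
    exact: cg.
  exact: cvg_dyadic_floor.
move=> n.
pose E (i : nat) : set (R * Omega) :=
  [set z | (nat_int i)%:~R / 2 ^+ n <= z.1 < ((nat_int i)%:~R + 1) / 2 ^+ n].
have p2 : 0 < 2 ^+ n :> R by exact: exprn_gt0.
have EU : \bigcup_i E i = setT.
  apply/seteqP; split=> // -[t w] _; exists (pickle (Num.floor (t * 2 ^+ n))) => //.
  rewrite /E /= nat_intK; have /andP[h1 h2] := floor_itv (t * 2 ^+ n).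
  by rewrite ler_pdivrMr// ltr_pdivlMr// h1 -[1]/(1%:~R) -intrD.
have mE i : measurable (E i).
  rewrite [X in measurable X](_ : _ = `[(nat_int i)%:~R / 2 ^+ n,
      ((nat_int i)%:~R + 1) / 2 ^+ n[%classic `*` setT).
    by apply: measurableX.
  by apply/seteqP; split=> -[t w] /=; rewrite in_itv/=; [move=> ?; split|case].
rewrite -EU; apply/measurable_fun_bigcup => // i.
apply: (@eq_measurable_fun _ _ _ _ _ (fun z : R * Omega => g ((nat_int i)%:~R / 2 ^+ n) z.2)).
  move=> [t w]; rewrite inE => /andP[/= h1 h2].
  rewrite /dyadic_floor (@floor_def _ _ (nat_int i))//.
  by rewrite intrD -ler_pdivrMr// -ltr_pdivlMr// h1.
apply: measurable_funTS; apply: (measurableT_comp (mg _)).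
exact: measurable_snd.
Qed.

(** Tonelli applied to the jointly measurable process. *)
Lemma measurable_path_integral (D : set R) : measurable D ->
  measurable_fun setT (fun w =>
    fine (\int[lebesgue_measure]_(t in D) (expR (g t w))%:E)%E).
Proof.
move=> mD; apply: (measurableT_comp (@fine_measurable R setT measurableT)).
rewrite [X in measurable_fun _ X](_ : _ = (fun w =>
    \int[lebesgue_measure]_t (expR (g t w) * \1_D t)%:E)%E); last first.
  apply/funext => w; rewrite integral_mkcond; apply: eq_integral => t _.
  by rewrite patchE indicE; case: ifPn; rewrite ?mulr1 ?mulr0.
apply: (@measurable_fun_fubini_tonelli_G _ _ _ _ _ lebesgue_measure
  (fun z : R * Omega => (expR (g z.1 z.2) * \1_D z.1)%:E)).
  apply/measurable_EFinP; apply: measurable_funM.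
    by apply: (measurableT_comp (@measurable_expR R)); exact: measurable_path_joint.
  by apply: (measurableT_comp (measurable_indic mD)); exact: measurable_fst.
by move=> z; rewrite lee_fin mulr_ge0 ?expR_ge0.
Qed.

(* The supremum of an unbounded set is [0], like [fine +oo]. *)
Lemma measurable_path_sup (D : set R) (s : nat -> R) : (forall i, D (s i)) ->
  (forall w t r, D t -> r < g t w -> exists i, r < g (s i) w) ->
  measurable_fun setT (fun w => sup [set expR (g t w) | t in D]).
Proof.
move=> Ds sD.
have sE w : sup [set expR (g t w) | t in D] =
    fine (esups (fun i => (expR (g (s i) w))%:E) 0%N).
  set A := [set _ | _ in D].
  have A0 : A !=set0 by exists (expR (g (s 0%N) w)), (s 0%N).
  have h : esups (fun i => (expR (g (s i) w))%:E) 0%N = ereal_sup (EFin @` A).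
    apply/eqP; rewrite eq_le; apply/andP; split; apply: ge_ereal_sup.
      move=> _ [i _ <-]; apply: ereal_sup_ubound; exists (expR (g (s i) w)) => //.
      by exists (s i).
    move=> _ [_ [t Dt <-] <-]; rewrite leNgt; apply/negP => lt.
    have : exists2 r, r < g t w & (esups (fun i => (expR (g (s i) w))%:E) 0%N <= (expR r)%:E)%E.
      have gei : ((expR (g (s 0%N) w))%:E <= esups (fun i => (expR (g (s i) w))%:E) 0%N)%E.
        by apply: ereal_sup_ubound; exists 0%N.
      move: lt gei; case: (esups _ _) => [x|//|//]; rewrite lte_fin lee_fin => xt gx.
      have x0 : 0 < x by apply: lt_le_trans gx; exact: expR_gt0.
      (* Here [x] is the countable supremum, assumed below the value at [t]; [ln x] is the level
         that [sD] lets some [s i] exceed. *)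
      exists (ln x); last by rewrite lnK.
      by rewrite -ltr_expR lnK.
    move=> [r rt]; rewrite leNgt => /negP; apply.
    have [i ri] := sD w t r Dt rt.
    apply: (@lt_le_trans _ _ (expR (g (s i) w))%:E); first by rewrite lte_fin ltr_expR.
    by apply: ereal_sup_ubound; exists i.
  rewrite h; have [hA|hA] := pselect (has_ubound A).
    by rewrite ereal_sup_EFin.
  rewrite sup_out; last by case.
  rewrite (_ : ereal_sup _ = +oo%E)//; apply/eqP; rewrite -leye_eq leNgt; apply/negP => lt.
  apply: hA; have : (ereal_sup (EFin @` A) \is a fin_num).
    rewrite fin_numElt lt andbT; have [x Ax] := A0.
    by apply: (@lt_le_trans _ _ x%:E); [rewrite ltNyr|apply: ereal_sup_ubound; exists x].
  move=> /fineK e; exists (fine (ereal_sup (EFin @` A))) => x Ax.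
  by rewrite -lee_fin e; apply: ereal_sup_ubound; exists x.
under eq_fun do rewrite sE.
apply: (measurableT_comp (@fine_measurable R setT measurableT)).
apply: measurable_fun_esups => i; apply/measurable_EFinP.
exact: (measurableT_comp (@measurable_expR R)).
Qed.

Lemma measurable_path_sup_grid (delta : R) (A : set int) : A 0 ->
  measurable_fun setT (fun w => sup [set expR (g (k%:~R * delta) w) | k in A]).
Proof.
move=> A0; pose D := [set k%:~R * delta | k in A].
under eq_fun => w.
  rewrite (_ : [set expR (g (k%:~R * delta) w) | k in A] = [set expR (g t w) | t in D]).
  over.
  by rewrite /D image_comp.
(* Indices outside [A] are sent to 0, which belongs to [A]. *)
pose s i := (if `[< A (nat_int i) >] then nat_int i else 0)%:~R * delta.
apply: (@measurable_path_sup _ s) => [i|w _ r [k Ak <-] rk].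
  by rewrite /s; case: ifPn => [/asboolP h|_]; [exists (nat_int i)|exists 0].
by exists (pickle k); rewrite /s nat_intK asboolT.
Qed.

(** [c] is a continuous retraction onto [D]: images of dyadic points stay in [D] and come
    arbitrarily close to each of its points. *)
Lemma measurable_path_sup_continuum (D : set R) (c : R -> R) : continuous c ->
  (forall t, D (c t)) -> (forall t, D t -> c t = t) ->
  measurable_fun setT (fun w => sup [set expR (g t w) | t in D]).
Proof.
move=> cc Dc cD.
pose s (i : nat) : R := let nk : nat * int := odflt (0%N, 0) (unpickle i) in
  c (nk.2%:~R / 2 ^+ nk.1).
apply: (@measurable_path_sup _ s) => [i|w t r Dt rt]; first exact: Dc.
have h : g (c (dyadic_floor n t)) w @[n --> \oo] --> g t w.
  apply: (@continuous_cvg _ _ _ _ _ _ (fun t => g t w)); first exact: cg.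
  rewrite -[X in _ --> X](cD _ Dt).
  by apply: continuous_cvg; [exact: cc|exact: cvg_dyadic_floor].
have [n /= rn] := filter_ex (cvgr_gt _ h _ rt).
by exists (pickle (n, Num.floor (t * 2 ^+ n))); rewrite /s pickleK.
Qed.

End path_measurability.

(** * The two ratios as a supremum over a mass, and their measurability *)

Definition grid (R : realType) (delta : R) : set R :=
  if delta == 0 then setT else [set k%:~R * delta | k in [set: int]].

Lemma xi_truncE (R : realType) (delta T : R) (f : R -> R) :
  xi_trunc delta T f =
  sup [set expR (f t) | t in grid delta `&` [set t | `|t| <= T]] / mass_trunc delta T f.
Proof.
rewrite /xi_trunc /mass_trunc /grid; case: eqVneq => _; congr (sup _ / _).
  rewrite setTI; congr (_ @` _); apply/seteqP.
  by split=> t /=; rewrite in_itv/= ler_norml.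
apply/seteqP; split.
  by move=> _ [k kT <-]; exists (k%:~R * delta) => //; split=> //; exists k.
by move=> _ [_ [[k _ <-] kT] <-]; exists k.
Qed.

Lemma xi_fullE (R : realType) (delta : R) (f : R -> R) :
  xi_full delta f = sup [set expR (f t) | t in grid delta] / mass_full delta f.
Proof.
rewrite /xi_full /mass_full /grid; case: eqVneq => _ //; congr (sup _ / _).
by rewrite image_comp.
Qed.

Section xi_measurability.
Context d (Omega : measurableType d) (R : realType) (g : R -> Omega -> R).
Hypothesis mg : forall t, measurable_fun setT (g t).
Hypothesis cg : forall w, continuous (fun t => g t w).

Let mexp t : measurable_fun setT (fun w => expR (g t w)).
Proof. exact: (measurableT_comp (@measurable_expR R)). Qed.

Let measurable_ratio_powR (p : R) (X Y : Omega -> R) : (forall w, 0 <= Y w) ->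
  measurable_fun setT X -> measurable_fun setT Y ->
  measurable_fun setT (fun w => (X w / Y w) `^ p).
Proof.
move=> Y0 mX mY; apply: (measurableT_comp (@measurable_powR R p)).
(* The inverse becomes the power [- 1], which is valid because [Y] is nonnegative. *)
under eq_fun do rewrite -powR_inv1//.
by apply: measurable_funM => //; apply: (measurableT_comp (@measurable_powR R (- 1))).
Qed.

Lemma measurable_xi_trunc (delta T p : R) : 0 <= delta -> 0 <= T ->
  measurable_fun setT (fun w => xi_trunc delta T (g ^~ w) `^ p).
Proof.
move=> d0 T0; rewrite /xi_trunc; case: eqVneq => [_|dn0]; apply: measurable_ratio_powR.
- by move=> w; rewrite fine_ge0// integral_ge0// => t _; rewrite lee_fin expR_ge0.
(* The retraction onto [[-T, T]] clamps [t] at both ends. *)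
- apply: (measurable_path_sup_continuum mg cg
    (c := (fun=> - T : R^o) \max ((fun=> T : R^o) \min id))).
  + move=> t; apply: (@continuous_max R R _ _ t); first exact: cst_continuous.
    by apply: (@continuous_min R R _ _ t); [exact: cst_continuous|exact: cvg_id].
  + by move=> t; rewrite /= in_itv/= le_max lexx ge_max ge_min lexx/= andbT; lra.
  + by move=> t /=; rewrite in_itv/= => /andP[t1 t2]; rewrite min_r// max_r.
- exact: measurable_path_integral.
- by move=> w; rewrite mulr_ge0// fsumr_ge0// => k _; exact: expR_ge0.
- by apply: measurable_path_sup_grid => //=; rewrite mul0r normr0.
- have finA : finite_set [set k : int | `|k%:~R * delta| <= T].
    by apply: finite_grid; rewrite lt_neqAle eq_sym dn0.
  apply: measurable_funM => //; under eq_fun do rewrite fsbig_finite//.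
  exact: measurable_sum.
Qed.

Lemma measurable_xi_full (delta p : R) : 0 <= delta ->
  measurable_fun setT (fun w => xi_full delta (g ^~ w) `^ p).
Proof.
move=> d0; rewrite /xi_full; case: eqVneq => [_|dn0]; apply: measurable_ratio_powR.
- by move=> w; rewrite fine_ge0// integral_ge0// => t _; rewrite lee_fin expR_ge0.
- by apply: (measurable_path_sup_continuum mg cg (c := id)) => // t; exact: cvg_id.
- exact: measurable_path_integral.
- by move=> w; rewrite mulr_ge0// fine_ge0// esum_ge0// => k _; rewrite lee_fin expR_ge0.
- by apply: measurable_path_sup_grid.
- apply: measurable_funM => //.
  apply: (measurableT_comp (@fine_measurable R setT measurableT)).
  (* The sum over the integers becomes a series over their codes; the test on [pickle k] discards
     naturals that decode without being codes. *)
  pose u w (i : nat) : R := if unpickle i is Some k then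
    (if pickle (k : int) == i then expR (g (k%:~R * delta) w) else 0) else 0.
  have u0 w i : (0 <= (u w i)%:E)%E.
    by rewrite /u; case: (unpickle i) => [k|]//; case: ifP => _ //; rewrite lee_fin expR_ge0.
  rewrite [X in measurable_fun _ X](_ : _ = (fun w => \sum_(i <oo) (u w i)%:E)%E).
    apply: ge0_emeasurable_sum => [i w _ _|i _]; first exact: u0.
    apply/measurable_EFinP; rewrite /u.
    case: (unpickle i) => [k|]; last exact: measurable_cst.
    by case: (pickle k == i); [exact: mexp|exact: measurable_cst].
  apply/funext => w; rewrite nneseries_esumT; last exact: u0.
  rewrite [RHS](esumID (range (pickle : int -> nat))); last by move=> i _; exact: u0.
  rewrite !setTI [X in (_ + X)%E]esum1 ?adde0; last first.
    move=> i /= iN; rewrite /u; case: (unpickle i) => [k|//]; case: eqVneq => // ki.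
    by exfalso; apply: iN; exists k.
  rewrite esum_image; last by move=> i j _ _; exact: (pcan_inj pickleK).
  by apply: eq_esum => k _; rewrite /u pickleK eqxx.
Qed.

End xi_measurability.

(** Where [W] is infinite the domination is trivial, so the bound on [Y] is asked only where [W] is
    finite. *)
Lemma ae_majorant_integral_le d (Omega : measurableType d) (R : realType)
    (P : {measure set Omega -> \bar R}) (W : Omega -> \bar R) (Y : Omega -> R) (K c : R) :
  measurable_fun setT W -> (forall w, 0 <= W w)%E -> (\int[P]_w W w <= K%:E)%E ->
  measurable_fun setT Y -> 0 < c ->
  {ae P, forall w, W w \is a fin_num -> `|Y w| <= c * fine (W w)} ->
  (\int[P]_w `|(Y w)%:E| <= (c * K)%:E)%E /\ P.-integrable setT (EFin \o Y).
Proof.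
move=> mW W0 WK mY c0 YW.
have le1 : (\int[P]_w `|(Y w)%:E| <= (c * K)%:E)%E.
  apply: (@le_trans _ _ (\int[P]_w (c%:E * W w))%E); last first.
    by rewrite ge0_integralZl// ?lee_fin ?(ltW c0)// EFinM lee_wpmul2l// lee_fin ltW.
  apply: ae_ge0_le_integral => //.
  - by apply: measurableT_comp => //; exact/measurable_EFinP.
  - by move=> w _; rewrite mule_ge0// lee_fin ltW.
  - exact: measurable_funeM.
  - apply: filterS YW => w Yw _.
    have [Wy|Wfin] := eqVneq (W w) +oo%E.
      by rewrite Wy gt0_muley ?lte_fin// leey.
    have Wf : W w \is a fin_num by rewrite ge0_fin_numE// ltey.
    by rewrite -(fineK Wf) -EFinM abse_EFin lee_fin; exact: Yw.
split => //.
apply/integrableP; split; first exact/measurable_EFinP.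
by apply: le_lt_trans le1 _; exact: ltry.
Qed.

(** * The main estimate *)

(** The pathwise estimates with [L = ln v]. All three bounds are linear in [v], so that they can be
    integrated with [v] the value of the majorant. *)
Lemma xi_path_bounds (R : realType) (a p : R) : 0 < a < 2 -> 0 < p ->
  exists2 C : R, 0 < C &
  forall (b : R -> R) (v : R), b 0 = 0 -> continuous b ->
  (forall (k : int) (u : R), `|u| <= 1 ->
    expR ((8 * p + 1) * `|b (k%:~R + u) - b k%:~R| + b k%:~R / 4
      - 3 / 16 * `|k%:~R| `^ a) <= v) ->
  let f t := b t - `|t| `^ a in
  forall delta T, 0 <= delta <= 1 -> 1 <= T ->
  [/\ xi_trunc delta T f `^ p <= C * v, xi_full delta f `^ p <= C * v &
   `|xi_trunc delta T f `^ p - xi_full delta f `^ p|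
     <= C * expR (- (256^-1 * T `^ a)) * v].
Proof.
move=> a02 p0; have a0 : 0 < a by case/andP: a02.
have [kap kap0 hkap] := @masses_bound R a a0.
pose C := (1 + p) * expR (2 * p + (kap + 3) / 8).
exists C; first by rewrite mulr_gt0 ?expR_gt0//; lra.
move=> b v b0 cb dom f delta T d01 T1.
have v0 : 0 < v.
  by apply: lt_le_trans (dom 0 0 _); rewrite ?expR_gt0 ?normr0.
have dom' k u : `|u| <= 1 -> (8 * p + 1) * `|b (k%:~R + u) - b k%:~R|
    + b k%:~R / 4 - 3 / 16 * `|k%:~R| `^ a <= ln v.
  by move=> u1; rewrite -ler_expR lnK ?posrE//; exact: dom.
have cf : continuous f.
  move=> t; apply: cvgB; first exact: cb.
  exact: continuous_powR_norm.
have fM t : f t <= 4 * ln v + 1 - `|t| `^ a / 16 by exact: (path_upper a02 p0 dom').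
have D0 : grid delta 0.
  by rewrite /grid; case: ifP => // _; exists 0 => //; rewrite mul0r.
have [m1 m2 m3] := hkap _ _ _ d01 cf fM T T1.
(* The full mass exceeds every truncated mass, hence inherits its lower bound at all scales. *)
have m4 (T' : R) : 1 <= T' -> forall (m : int) l, - T' <= m%:~R -> m%:~R + 1 <= T' ->
    (forall t, m%:~R <= t <= m%:~R + 1 -> l <= f t) ->
    expR (l - 1) <= mass_full delta f.
  move=> T'1 m l mT mT' fl; have [n1 n2 _] := hkap _ _ _ d01 cf fM T' T'1.
  by apply: le_trans n2; exact: n1 fl.
have := ratio_powR_diff a02 p0 b0 dom' D0 T1 kap0 m1 m4 m2 m3.
rewrite -/f -xi_truncE -xi_fullE lnK ?posrE// => -[h1 h2 h3].
have le_C : expR (2 * p) <= C.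
  rewrite -[leLHS]mul1r; apply: ler_pM; rewrite ?expR_ge0// ?ler_expR; lra.
split; [apply: le_trans h1 _|apply: le_trans h2 _|exact: h3].
- by rewrite ler_wpM2r// ltW.
- by rewrite ler_wpM2r// ltW.
Qed.

Unset Implicit Arguments.
Set Strict Implicit.
Set Printing Implicit Defensive.

Theorem theorem2p4 (R : realType) (a p : R) :
  0 < a < 2 -> 0 < p ->
  exists C1 C2 : R, 0 < C1 /\ 0 < C2 /\
    forall (d : measure_display) (Omega : measurableType d)
           (P : probability Omega R) (B : R -> Omega -> R),
      is_fBm P a B ->
      forall delta T : R, 0 <= delta <= 1 -> 1 <= T ->
        P.-integrable setT (fun w => ((xi_trunc delta T (Zproc a B w)) `^ p)%:E) /\
        P.-integrable setT (fun w => ((xi_full delta (Zproc a B w)) `^ p)%:E) /\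
        (`| \int[P]_w ((xi_trunc delta T (Zproc a B w)) `^ p)%:E
            - \int[P]_w ((xi_full delta (Zproc a B w)) `^ p)%:E |
          <= (C1 * expR (- (C2 * T `^ a)))%:E)%E.
Proof.
move=> a02 p0; have a0 : 0 < a by case/andP: a02.
have [C C0 hC] := @xi_path_bounds R a p a02 p0.
have lam0 : 0 < 8 * p + 1 by lra.
have [K K0 hK] := fBm_majorant a0 lam0.
exists (C * K), 256^-1; split; first exact: mulr_gt0.
split; first by lra.
move=> d Omega P B fB delta T d01 T1.
have [W [mW W0 WK hW]] := hK d Omega P B fB.
have d0 : 0 <= delta by case/andP: d01.
pose g t w := Zproc a B w t.
have mg t : measurable_fun setT (g t).
  by apply: measurable_funB => //; exact: (measurable_scaled_fBm fB).
have cb w : continuous (fun t => Num.sqrt 2 * B t w).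
  move=> t; apply: cvgM; first exact: cvg_cst.
  exact: (continuous_fBm fB).
have cg w : continuous (fun t => g t w).
  by move=> t; apply: cvgB; [exact: cb|exact: continuous_powR_norm].
pose X w := xi_trunc delta T (Zproc a B w) `^ p.
pose X' w := xi_full delta (Zproc a B w) `^ p.
have mX : measurable_fun setT X.
  by apply: (measurable_xi_trunc mg cg) => //; lra.
have mX' : measurable_fun setT X' by exact: (measurable_xi_full mg cg).
have B0ae : {ae P, forall w, B 0 w = 0}.
  have mB0 : measurable [set w | B 0 w = 0].
    rewrite -[X in measurable X]setTI.
    have h := measurable_fBm fB 0 measurableT (measurable_set1 (0 : R)).
    exact: h.
  exists (~` [set w | B 0 w = 0]); split => //; first exact: measurableC.
  by apply: etrans (probability_setC P mB0) _; rewrite (fBm0 a0 fB) subee.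
have bounds w : B 0 w = 0 -> W w \is a fin_num ->
    [/\ X w <= C * fine (W w), X' w <= C * fine (W w) &
      `|X w - X' w| <= C * expR (- (256^-1 * T `^ a)) * fine (W w)].
  move=> B0 Wf; apply: (hC (fun t => Num.sqrt 2 * B t w)) => //.
    by rewrite B0 mulr0.
  by move=> k u u1; rewrite -lee_fin fineK//; exact: hW.
have [_ iX] : (\int[P]_w `|(X w)%:E| <= (C * K)%:E)%E /\ P.-integrable setT (EFin \o X).
  apply: (ae_majorant_integral_le mW W0 WK) => //.
  apply: filterS B0ae => w /bounds h /h[+ _ _].
  by rewrite ger0_norm// powR_ge0.
have [_ iX'] : (\int[P]_w `|(X' w)%:E| <= (C * K)%:E)%E /\ P.-integrable setT (EFin \o X').
  apply: (ae_majorant_integral_le mW W0 WK) => //.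
  apply: filterS B0ae => w /bounds h /h[_ + _].
  by rewrite ger0_norm// powR_ge0.
split; first exact: iX.
split; first exact: iX'.
have mXX : measurable_fun setT (fun w => X w - X' w) by exact: measurable_funB.
have [le_diff _] := @ae_majorant_integral_le _ _ _ P W (fun w => X w - X' w) K
  (C * expR (- (256^-1 * T `^ a))) mW W0 WK mXX (mulr_gt0 C0 (expR_gt0 _))
  (filterS (fun w h Wf => let: And3 _ _ h' := bounds w h Wf in h') B0ae).
(* Integrability of both powers turns the difference of expectations into the expectation of the
   difference. *)
rewrite -integralB//; apply: le_trans (le_abse_integral _ _ _) _ => //.
  exact/measurable_EFinP.
rewrite mulrAC; exact: le_diff.
Qed.
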